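(* The calculi $\overline{\sharp{\sf S5}}_n$ and $\sharp{\sf S5}_n$ are sound and complete: for every (proper) cross-sequent $\mathcal{S}$, the following are equivalent: (i) $\vdash_{\sharp{\sf S5}_n}\mathcal{S}$; (ii) $\vdash_{\overline{\sharp{\sf S5}}_n}\mathcal{S}$; (iii) $\mathcal{S}$ is valid.
   Context: Formulas over a countably infinite set $\mathrm{Prop}$ of atoms and finite nonempty agent set $A$ ($n=|A|$), in negation normal form: $\phi::=\bot\mid\top\mid p\mid\neg p\mid(\phi\wedge\phi)\mid(\phi\vee\phi)\mid\Box_a\phi\mid\Diamond_a\phi$. Epistemic model $\mathcal{M}=(W,R,V)$: $W\neq\varnothing$, $R_a$ equivalence relations, $V:\mathrm{Prop}\to\mathcal{P}(W)$; standard truth. A sequent is a finite set of formulas. Cross-sequents/hypersequents by mutual recursion: every sequent is a cross-sequent; a hypersequent $H=\mathcal{S}_1|\dots|\mathcal{S}_m$ ($m\ge1$) is a finite multiset of cross-sequents; if $\mathcal{S}$ is a cross-sequent, $a\in A$, $H$ a hypersequent, then $\mathcal{S},[H]_a$ is a cross-sequent. A cross-sequent is a finite tree of sequents (components); roots of members of $H$ are the $a$-children of the root of $\mathcal{S},[H]_a$ (their $a$-parent) and $a$-siblings of each other. Proper: (a) each component has at most one $a$-bracket per agent; (b) no $a$-child is an $a$-parent; all cross-sequents are proper. $a$-cluster $[\Gamma]_a$: $\Gamma$, its $a$-parent, $a$-siblings, $a$-children. Labeling: distinct nonnegative integers on components, root $0$. Interpretation of labeled $\mathcal{S}$ into $\mathcal{M}$: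 a map from a superset of labels into $W$ with $\Delta\in[\Gamma]_a\Rightarrow[\ell(\Gamma)]R_a[\ell(\Delta)]$; $\mathcal{M},[\cdot]\vDash\mathcal{S}$ iff some formula of some component $\Gamma$ is true at $[\ell(\Gamma)]$; valid iff true under all models and interpretations. Calculus $\sharp{\sf S5}_n$ ($\mathcal{S}\{X\}$ = hole filled by $X$; $\psi,\mathcal{T}$ = $\psi$ added to root component of $\mathcal{T}$; all cross-sequents proper; premises / conclusion): axioms $\mathrm{id}$: $\mathcal{S}\{p,\neg p\}$, $\top$: $\mathcal{S}\{\top\}$; $\vee$: $\mathcal{S}\{\phi\vee\psi,\phi,\psi\}/\mathcal{S}\{\phi\vee\psi\}$; $\wedge$: $\mathcal{S}\{\phi\wedge\psi,\phi\}$, $\mathcal{S}\{\phi\wedge\psi,\psi\}/\mathcal{S}\{\phi\wedge\psi\}$; $\Box\in a$: $\mathcal{S}\{[\phi\mid\Box_a\phi,\mathcal{T}\mid H]_a\}/\mathcal{S}\{[\Box_a\phi,\mathcal{T}\mid H]_a\}$; $\Box\nearrow a$: $\mathcal{S}\{\Box_a\phi,[\phi\mid H]_a\}/\mathcal{S}\{\Box_a\phi,[H]_a\}$; $\Box\not\rightsquigarrow a$: $\mathcal{S}\{\Box_a\phi,[\phi]_a\}/\mathcal{S}\{\Box_a\phi\}$ if the component of $\Box_a\phi$ has no $a$-children; $\Diamond\in a$: $\mathcal{S}\{[\Diamond_a\phi,\mathcal{T}\mid\phi,\mathcal{U}\mid H]_a\}/\mathcal{S}\{[\Diamond_a\phi,\mathcal{T}\mid\mathcal{U}\mid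 H]_a\}$; $\Diamond\nearrow a$: $\mathcal{S}\{\Diamond_a\phi,[\phi,\mathcal{T}\mid H]_a\}/\mathcal{S}\{\Diamond_a\phi,[\mathcal{T}\mid H]_a\}$; $\Diamond Ta$: $\mathcal{S}\{\Diamond_a\phi,\phi\}/\mathcal{S}\{\Diamond_a\phi\}$; $\Diamond\searrow a$: $\mathcal{S}\{\phi,\mathcal{T},[\Diamond_a\phi,\mathcal{U}\mid H]_a\}/\mathcal{S}\{\mathcal{T},[\Diamond_a\phi,\mathcal{U}\mid H]_a\}$. $\vdash\mathcal{S}$: there is a finite proof tree with root $\mathcal{S}$ and axiom leaves. Saturation of an occurrence in component $\Gamma$: $\top$ never; $\bot$ always; a literal iff its opposite is not in $\Gamma$; $\phi\vee\psi$ iff $\{\phi,\psi\}\subseteq\Gamma$; $\phi\wedge\psi$ iff $\{\phi,\psi\}\cap\Gamma\ne\varnothing$; $\Box_a\phi$ iff $\phi\in\Delta$ for some $\Delta\in[\Gamma]_a$; $\Diamond_a\phi$ iff $\phi\in\Delta$ for all $\Delta\in[\Gamma]_a$. $\overline{\sharp{\sf S5}}_n$ is the restriction of $\sharp{\sf S5}_n$ where rules are applied (bottom-up) only to unsaturated formulas, with priority: $\top$; then $\mathrm{id}$ on an unsaturated literal; then $\vee$; then $\wedge$; then the $\Diamond$-rule adding $\phi$ to a component of $[\Gamma]_a$ missing it for unsaturated $\Diamond_a\phi\in\Gamma$; then the applicable $\Box$-rule for an unsaturated $\Box_a\phi$. *)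

(* Defs.v *)
From Stdlib Require Import Permutation RelationClasses.
From HB Require Import structures.
From mathcomp Require Import all_boot finmap.

Set Implicit Arguments.
Unset Strict Implicit.
Unset Printing Implicit Defensive.

Local Open Scope fset_scope.

Inductive form (At A : Type) : Type :=
  | Bot | Top
  | Pos of At | Neg of At
  | And of form At A & form At A
  | Or of form At A & form At A
  | Box of A & form At A
  | Dia of A & form At A.
Arguments Bot {At A}.
Arguments Top {At A}.
Arguments Pos {At A} _.
Arguments Neg {At A} _.

(* Countable-type structure on formulas, needed for finite sets of formulas. *)
Section FormCountable.
Variables At A : countType.

Fixpoint form_encode (f : form At A) : GenTree.tree (At + A) :=
  match f with
  | Bot => GenTree.Node 0 [::]
  | Top => GenTree.Node 1 [::]
  | Pos p => GenTree.Node 2 [:: GenTree.Leaf (inl p)]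
  | Neg p => GenTree.Node 3 [:: GenTree.Leaf (inl p)]
  | And f g => GenTree.Node 4 [:: form_encode f; form_encode g]
  | Or f g => GenTree.Node 5 [:: form_encode f; form_encode g]
  | Box a f => GenTree.Node 6 [:: GenTree.Leaf (inr a); form_encode f]
  | Dia a f => GenTree.Node 7 [:: GenTree.Leaf (inr a); form_encode f]
  end.

Fixpoint form_decode (t : GenTree.tree (At + A)) : option (form At A) :=
  match t with
  | GenTree.Node 0 [::] => Some Bot
  | GenTree.Node 1 [::] => Some Top
  | GenTree.Node 2 [:: GenTree.Leaf (inl p)] => Some (Pos p)
  | GenTree.Node 3 [:: GenTree.Leaf (inl p)] => Some (Neg p)
  | GenTree.Node 4 [:: t1; t2] =>
      if (form_decode t1, form_decode t2) is (Some f, Some g)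
      then Some (And f g) else None
  | GenTree.Node 5 [:: t1; t2] =>
      if (form_decode t1, form_decode t2) is (Some f, Some g)
      then Some (Or f g) else None
  | GenTree.Node 6 [:: GenTree.Leaf (inr a); t1] =>
      if form_decode t1 is Some f then Some (Box a f) else None
  | GenTree.Node 7 [:: GenTree.Leaf (inr a); t1] =>
      if form_decode t1 is Some f then Some (Dia a f) else None
  | _ => None
  end.

Lemma form_encodeK : pcancel form_encode form_decode.
Proof.
by elim=> [||p|p|f IHf g IHg|f IHf g IHg|a f IHf|a f IHf] //=;
   rewrite ?IHf ?IHg.
Qed.

HB.instance Definition _ :=
  Countable.copy (form At A) (pcan_type form_encodeK).

End FormCountable.

Section Semantics.
Variables At A : Type.

Record model : Type := Model {
  world : Type;
  world_inhabited : inhabited world;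
  acc : A -> world -> world -> Prop;
  acc_equivalence : forall a, Equivalence (acc a);
  val_at : At -> world -> Prop
}.

Fixpoint sat (M : model) (w : world M) (f : form At A) : Prop :=
  match f with
  | Bot => False
  | Top => True
  | Pos p => val_at p w
  | Neg p => ~ val_at p w
  | And f g => sat w f /\ sat w g
  | Or f g => sat w f \/ sat w g
  | Box a f => forall v, acc a w v -> sat v f
  | Dia a f => exists v, acc a w v /\ sat v f
  end.

End Semantics.

Section Calculi.
Variable At : countType.
Variable A : finType.
Local Notation form := (form At A).

(* [CS G [:: (a1, H1); ...; (ak, Hk)]] is the cross-sequent
   G, [H1]_a1, ..., [Hk]_ak.  Hypersequents are lists here; the identification
   of lists differing only in the order of their members is [cs_eq] below, and
   the requirement that hypersequents be nonempty is part of [proper_cs]. *)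
Inductive cs : Type := CS of {fset form} & seq (A * seq cs).

Definition root_seq (S : cs) : {fset form} := let: CS G _ := S in G.
Definition brackets (S : cs) : seq (A * seq cs) := let: CS _ B := S in B.

Definition leaf (f : form) : cs := CS [fset f] [::].

(* The cross-sequent written  T, X : the roots are merged. *)
Definition cs_merge (X T : cs) : cs :=
  CS (root_seq X `|` root_seq T) (brackets X ++ brackets T).

Definition cs_add (f : form) (T : cs) : cs := cs_merge (leaf f) T.

(* Cross-sequents with a hole: [CHole T] is  T, { }  and [CIn T a C H] is
   T, [ C | H ]_a , where H may be empty. *)
Inductive ctx : Type :=
  | CHole of cs
  | CIn of cs & A & ctx & seq cs.

Fixpoint fill (C : ctx) (X : cs) : cs :=
  match C with
  | CHole T => cs_merge X T
  | CIn T a C H => cs_merge (CS fset0 [:: (a, fill C X :: H)]) T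
  end.

(* Hypersequents are multisets, and the brackets attached to a component are
   unordered: cross-sequents are identified up to [cs_eq]. *)
Inductive cs_eq : cs -> cs -> Prop :=
  | cs_eq_refl S : cs_eq S S
  | cs_eq_sym S T : cs_eq S T -> cs_eq T S
  | cs_eq_trans S T U : cs_eq S T -> cs_eq T U -> cs_eq S U
  | cs_eq_brackets C G B B' :
      Permutation B B' -> cs_eq (fill C (CS G B)) (fill C (CS G B'))
  | cs_eq_hyper C a H H' :
      Permutation H H' ->
      cs_eq (fill C (CS fset0 [:: (a, H)])) (fill C (CS fset0 [:: (a, H')])).

(* A component is addressed by its path from the root; a step (j, i) goes to
   the i-th member of the j-th bracket. *)
Definition pos : Type := seq (nat * nat).

Fixpoint subtree (S : cs) (x : pos) : option cs :=
  if x is (j, i) :: x' then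
    if onth (brackets S) j is Some (_, H) then
      if onth H i is Some T then subtree T x' else None
    else None
  else Some S.

Definition component (S : cs) (x : pos) : Prop := subtree S x <> None.

Definition comp_seq (S : cs) (x : pos) : {fset form} :=
  if subtree S x is Some T then root_seq T else fset0.

(* [child S a x y]: the component at y is an a-child of the one at x. *)
Definition child (S : cs) (a : A) (x y : pos) : Prop :=
  exists j i T H,
    [/\ y = rcons x (j, i), subtree S x = Some T,
        onth (brackets T) j = Some (a, H) & i < size H].

(* [cluster S a x y]: y lies in the a-cluster of x. *)
Definition cluster (S : cs) (a : A) (x y : pos) : Prop :=
  [\/ y = x, child S a y x, child S a x y
    | exists z, child S a z x /\ child S a z y].

(* The clause [0 < size b.2] is the nonemptiness of hypersequents. *)
Definition proper_cs (S : cs) : Prop :=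
  [/\ forall x T, subtree S x = Some T -> all (fun b => 0 < size b.2) (brackets T),
      forall x T, subtree S x = Some T -> uniq [seq b.1 | b <- brackets T]
    & forall a x y z, child S a x y -> ~ child S a y z].

Definition labeling (S : cs) (l : pos -> nat) : Prop :=
  l [::] = 0 /\
  forall x y, component S x -> component S y -> l x = l y -> x = y.

(* An interpretation is a partial map on labels. *)
Definition interpretation (S : cs) (l : pos -> nat) (M : model At A)
    (I : nat -> option (world M)) : Prop :=
  (forall x, component S x -> I (l x) <> None) /\
  (forall a x y v w, component S x -> component S y -> cluster S a x y ->
     I (l x) = Some v -> I (l y) = Some w -> acc a v w).

Definition holds (S : cs) (l : pos -> nat) (M : model At A)
    (I : nat -> option (world M)) : Prop :=
  exists x f w,
    [/\ component S x, f \in comp_seq S x, I (l x) = Some w & sat w f].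

Definition valid (S : cs) : Prop :=
  forall l, labeling S l ->
  forall (M : model At A) (I : nat -> option (world M)),
    interpretation S l I -> holds S l I.

(* Position of the hole of C in [fill C X]. *)
Fixpoint hole (C : ctx) : pos :=
  if C is CIn _ _ C' _ then (0, 0) :: hole C' else [::].

(* [rule_inst Ps S f x y]: Ps / S is an instance of a rule, with principal
   formula f in the component x of S; for the diamond rules, y is the component
   of S to which the immediate subformula of f is added (elsewhere y = x).
   For [id] the principal formula is either one of the two literals. *)
Inductive rule_inst : seq cs -> cs -> form -> pos -> pos -> Prop :=
  | R_id_pos C p :
      rule_inst [::] (fill C (CS [fset Pos p; Neg p] [::]))
        (Pos p) (hole C) (hole C)
  | R_id_neg C p :
      rule_inst [::] (fill C (CS [fset Pos p; Neg p] [::]))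
        (Neg p) (hole C) (hole C)
  | R_top C :
      rule_inst [::] (fill C (leaf Top)) Top (hole C) (hole C)
  | R_or C f g :
      rule_inst [:: fill C (CS [fset Or f g; f; g] [::])]
        (fill C (leaf (Or f g))) (Or f g) (hole C) (hole C)
  | R_and C f g :
      rule_inst [:: fill C (CS [fset And f g; f] [::]);
                    fill C (CS [fset And f g; g] [::])]
        (fill C (leaf (And f g))) (And f g) (hole C) (hole C)
  | R_box_in C a f T H :
      rule_inst [:: fill C (CS fset0 [:: (a, leaf f :: cs_add (Box a f) T :: H)])]
        (fill C (CS fset0 [:: (a, cs_add (Box a f) T :: H)]))
        (Box a f) (rcons (hole C) (0, 0)) (rcons (hole C) (0, 0))
  | R_box_up C a f H :
      rule_inst [:: fill C (CS [fset Box a f] [:: (a, leaf f :: H)])]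
        (fill C (CS [fset Box a f] [:: (a, H)]))
        (Box a f) (hole C) (hole C)
  | R_box_new C a f :
      (forall z, ~ child (fill C (leaf (Box a f))) a (hole C) z) ->
      rule_inst [:: fill C (CS [fset Box a f] [:: (a, [:: leaf f])])]
        (fill C (leaf (Box a f)))
        (Box a f) (hole C) (hole C)
  | R_dia_in C a f T U H :
      rule_inst [:: fill C (CS fset0 [:: (a, cs_add (Dia a f) T :: cs_add f U :: H)])]
        (fill C (CS fset0 [:: (a, cs_add (Dia a f) T :: U :: H)]))
        (Dia a f) (rcons (hole C) (0, 0)) (rcons (hole C) (0, 1))
  | R_dia_up C a f T H :
      rule_inst [:: fill C (CS [fset Dia a f] [:: (a, cs_add f T :: H)])]
        (fill C (CS [fset Dia a f] [:: (a, T :: H)]))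
        (Dia a f) (hole C) (rcons (hole C) (0, 0))
  | R_dia_T C a f :
      rule_inst [:: fill C (CS [fset Dia a f; f] [::])]
        (fill C (leaf (Dia a f)))
        (Dia a f) (hole C) (hole C)
  | R_dia_down C a f T U H :
      rule_inst
        [:: fill C (cs_merge (CS fset0 [:: (a, cs_add (Dia a f) U :: H)]) (cs_add f T))]
        (fill C (cs_merge (CS fset0 [:: (a, cs_add (Dia a f) U :: H)]) T))
        (Dia a f) (rcons (hole C) (0, 0)) (hole C).

(* Derivability by rule instances, read bottom-up, that are allowed by [ok]. *)
Inductive derivable (ok : cs -> form -> pos -> pos -> Prop) : cs -> Prop :=
  | D_rule Ps S f x y :
      rule_inst Ps S f x y -> ok S f x y ->
      proper_cs S ->
      (forall P, List.In P Ps -> proper_cs P) ->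
      (forall P, List.In P Ps -> derivable ok P) ->
      derivable ok S
  | D_eq S T : cs_eq S T -> derivable ok S -> derivable ok T.

Definition saturated (S : cs) (x : pos) (f : form) : Prop :=
  match f with
  | Bot => True
  | Top => False
  | Pos p => Neg p \notin comp_seq S x
  | Neg p => Pos p \notin comp_seq S x
  | And f g => f \in comp_seq S x \/ g \in comp_seq S x
  | Or f g => f \in comp_seq S x /\ g \in comp_seq S x
  | Box a f => exists y, cluster S a x y /\ f \in comp_seq S y
  | Dia a f => forall y, cluster S a x y -> f \in comp_seq S y
  end.

Definition unsaturated (S : cs) (x : pos) (f : form) : Prop :=
  f \in comp_seq S x /\ ~ saturated S x f.

(* A smaller number is a higher priority; no rule treats Bot, and an occurrence
   of Bot is never unsaturated. *)
Definition priority (f : form) : nat :=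
  match f with
  | Top => 0
  | Pos _ | Neg _ => 1
  | Or _ _ => 2
  | And _ _ => 3
  | Dia _ _ => 4
  | Box _ _ => 5
  | Bot => 6
  end.

(* A rule for an unsaturated formula is available whenever there is one, so
   priority amounts to comparison with all unsaturated occurrences. *)
Definition allowed (S : cs) (f : form) (x y : pos) : Prop :=
  [/\ unsaturated S x f,
      forall z g, unsaturated S z g -> priority f <= priority g
    & if f is Dia _ g then g \notin comp_seq S y else True].

Definition provable : cs -> Prop := derivable (fun _ _ _ _ => True).
Definition provable_restricted : cs -> Prop := derivable allowed.

End Calculi.

(* Main.v *)
From Stdlib Require Import Permutation RelationClasses Classical ClassicalEpsilon.
Require Import Defs.
From mathcomp Require Import all_boot finmap.

(* A cross-sequent is falsified by some interpretation iff it is refuted as a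
   tree: its root formulas fail at some world w, and recursively each a-child is
   refuted at some world a-accessible from w. Every rule, read upwards, keeps
   such a refutation of one premise, which gives soundness.

   For completeness, restricted proof search terminates. A formula added to a
   component, or the formula of a new component, is the scope of a modality in
   the same cluster or a Boolean subformula in place. So, for D large enough, all
   formulas of a component at depth k keep modal depth at most D - k: a new
   a-child of a component of remaining budget d has budget d - 1, and a cluster
   receives at most one new component for each formula of the finite set of
   subformulas. Counting the formulas missing from a component with weight 1 and
   the formulas missing from a whole cluster with a weight exceeding the measure
   of a fresh child gives a natural number that drops at every step.

   If nothing is unsaturated, the components themselves, with the clusters as
   accessibility relations and p true where ~p occurs, refute the cross-sequent. *)

Set Implicit Arguments.
Unset Strict Implicit.
Unset Printing Implicit Defensive.

Section CrossSequents.
Local Open Scope fset_scope.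
Variable At : countType.
Variable A : finType.
Local Notation form := (form At A).
Local Notation cs := (cs At A).
Local Notation ctx := (ctx At A).
Implicit Types (S T U X Y P : cs) (C : ctx) (f g : form) (a b : A) (x y z : pos).
Implicit Types (G : {fset form}) (H : seq cs) (B : seq (A * seq cs)).

(** * Children, positions and subtrees *)

(** The position-free form of [child]. Refutation, bisimulation, properness and budgets are all
    defined by recursion on subtrees, where paths would only be a burden. *)
Definition kid S a T : Prop :=
  exists H, List.In (a, H) (brackets S) /\ List.In T H.

(** Children sit under two nested lists, so the generated eliminator of [cs] offers no hypothesis
    for them. The fixpoint descends through both lists until the child is a visible subterm. *)
Lemma cs_kid_ind (Q : cs -> Prop) :
  (forall S, (forall a T, kid S a T -> Q T) -> Q S) -> forall S, Q S.
Proof.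
move=> IH; fix rec 1 => -[G B]; apply: IH => a T [H [/= inB inH]].
elim: B inB => [[]|[b H'] B IHB] /= [[_ eqH]|]; last exact: IHB.
rewrite -eqH in inH; elim: H' inH {eqH} => [[]|T' H' IHH] /= [<-|]; last exact: IHH.
exact: rec.
Qed.

Lemma onth_In (I : Type) (s : seq I) v :
  List.In v s <-> exists i, onth s i = Some v.
Proof.
elim: s => [|u s IH]; first by split=> // -[[|i]].
split=> [[->|/IH[i Hi]]|[[|i] /= Hi]]; [by exists 0|by exists i.+1| |].
  by left; case: Hi.
by right; apply/IH; exists i.
Qed.

Lemma onth_lt (I : Type) (s : seq I) i :
  i < size s <-> exists v, onth s i = Some v.
Proof.
elim: s i => [|u s IH] [|i] //=; rewrite ?ltn0; try by split=> // -[].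
  by split=> // _; exists u.
exact: IH.
Qed.

(** A single step of [subtree] that also remembers the agent of the bracket entered. *)
Definition subtree1 S (k : nat * nat) : option (A * cs) :=
  if onth (brackets S) k.1 is Some (a, H) then
    if onth H k.2 is Some T then Some (a, T) else None
  else None.

Lemma subtree1P S k a T :
  subtree1 S k = Some (a, T) <->
  exists H, onth (brackets S) k.1 = Some (a, H) /\ onth H k.2 = Some T.
Proof.
rewrite /subtree1; case: onth => [[b H]|]; last by split=> // -[H []].
case E: (onth H k.2) => [U|]; split=> //.
- by case=> <- <-; exists H.
- by case=> H' [[<- <-]]; rewrite E => -[->].
by case=> H' [[_ <-]]; rewrite E.
Qed.

Lemma kidP S a T : kid S a T <-> exists k, subtree1 S k = Some (a, T).
Proof.
split=> [[H [/onth_In[j Hj] /onth_In[i Hi]]]|[k /subtree1P[H [Hj Hi]]]].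
  by exists (j, i); apply/subtree1P; exists H.
by exists H; split; apply/onth_In; [exists k.1|exists k.2].
Qed.

Lemma subtree_cons S k x :
  subtree S (k :: x) = if subtree1 S k is Some (_, T) then subtree T x else None.
Proof.
by case: k => j i; rewrite /subtree1 /=; case: onth => [[b H]|] //; case: onth.
Qed.

Lemma subtree_cat S x y :
  subtree S (x ++ y) = if subtree S x is Some T then subtree T y else None.
Proof.
elim: x S => [//|k x IH] S; rewrite cat_cons !subtree_cons.
by case: (subtree1 S k) => [[b T]|].
Qed.

Lemma subtree_rcons S x k :
  subtree S (rcons x k) =
  if subtree S x is Some T then
    if subtree1 T k is Some (_, U) then Some U else None
  else None.
Proof. by rewrite -cats1 subtree_cat; case: subtree => // T; rewrite subtree_cons. Qed.

Lemma childP S a x y :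
  child S a x y <->
  exists k T U, [/\ y = rcons x k, subtree S x = Some T & subtree1 T k = Some (a, U)].
Proof.
split=> [[j [i [T [H [-> ST Bj /onth_lt[U Hi]]]]]]|[k [T [U [-> ST /subtree1P[H [Hj Hi]]]]]]].
  by exists (j, i), T, U; split=> //; apply/subtree1P; exists H.
case: k Hj Hi => j i Hj Hi; exists j, i, T, H; split=> //.
by apply/onth_lt; exists U.
Qed.

Lemma child_subtree S a x y :
  child S a x y ->
  exists T U, [/\ subtree S x = Some T, subtree S y = Some U & kid T a U].
Proof.
case/childP=> k [T [U [-> ST TU]]]; exists T, U; split=> //.
  by rewrite subtree_rcons ST TU.
by apply/kidP; exists k.
Qed.

Lemma kid_child S x T a U :
  subtree S x = Some T -> kid T a U ->
  exists y, child S a x y /\ subtree S y = Some U.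
Proof.
move=> ST /kidP[k TU]; exists (rcons x k); split.
  by apply/childP; exists k, T, U.
by rewrite subtree_rcons ST TU.
Qed.

Lemma child_cons S a b k x y T :
  subtree1 S k = Some (b, T) -> child T a x y -> child S a (k :: x) (k :: y).
Proof.
move=> Sk /childP[k' [V [U [-> TV VU]]]]; apply/childP; exists k', V, U.
by rewrite subtree_cons Sk.
Qed.

Lemma child_inj S a b x y z : child S a x z -> child S b y z -> x = y.
Proof.
case/childP=> k [T [U [-> _ _]]] /childP[k' [T' [U' [/eqP]]]].
by rewrite eqseq_rcons => /andP[/eqP].
Qed.

Lemma kid_merge X T a U : kid (cs_merge X T) a U <-> kid X a U \/ kid T a U.
Proof.
split.
  by case=> H [/= /List.in_app_iff[] ? ?]; [left|right]; exists H.
by case=> -[H [? ?]]; exists H; split=> //=; apply/List.in_app_iff; [left|right].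
Qed.

Lemma kid1 G b H a U : kid (CS G [:: (b, H)]) a U <-> a = b /\ List.In U H.
Proof.
split; first by case=> H' [/= [[-> ->]|//]].
by case=> -> ?; exists H; split=> //; left.
Qed.

Lemma kid_nil G a U : ~ kid (CS G [::]) a U.
Proof. by case=> H []. Qed.

Lemma root_merge X T : root_seq (cs_merge X T) = root_seq X `|` root_seq T.
Proof. by []. Qed.

Lemma cs_mergeA X T U : cs_merge (cs_merge X T) U = cs_merge X (cs_merge T U).
Proof. by rewrite /cs_merge /= fsetUA catA. Qed.

Lemma cs_merge0 X : cs_merge X (CS fset0 [::]) = X.
Proof. by case: X => G B; rewrite /cs_merge /= fsetU0 cats0. Qed.

Lemma cs_merge_id G X : G `<=` root_seq X -> cs_merge (CS G [::]) X = X.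
Proof. by case: X => G' B /fsetUidPr sub; rewrite /cs_merge /= sub. Qed.

Lemma cs_add_id f X : f \in root_seq X -> cs_add f X = X.
Proof. by move=> fX; apply: cs_merge_id; rewrite fsub1set. Qed.

(** * Composition of contexts *)

Definition ctx_merge C T : ctx :=
  match C with
  | CHole T0 => CHole (cs_merge T0 T)
  | CIn T0 a C H => CIn (cs_merge T0 T) a C H
  end.

Fixpoint ctx_comp C C' : ctx :=
  match C with
  | CHole T => ctx_merge C' T
  | CIn T a C H => CIn T a (ctx_comp C C') H
  end.

Lemma fill_comp C C' X : fill (ctx_comp C C') X = fill C (fill C' X).
Proof.
elim: C => [T|T a C IH H] /=; last by rewrite IH.
by case: C' => [T'|T' a C' H] /=; rewrite cs_mergeA.
Qed.

Lemma hole_comp C C' : hole (ctx_comp C C') = hole C ++ hole C'.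
Proof. by elim: C => [T|T a C IH H] /=; [case: C'|rewrite IH]. Qed.

Fixpoint hole_rest C : cs := match C with CHole T => T | CIn _ _ C _ => hole_rest C end.

Lemma subtree_fill C X : subtree (fill C X) (hole C) = Some (cs_merge X (hole_rest C)).
Proof. by elim: C. Qed.

(** Rules display only the active part of a component. This moves the rest [T] of that component
    into the context, so that a rule applies to the component as a whole. *)
Lemma fill_rest C T X : fill (ctx_comp C (CHole T)) X = fill C (cs_merge X T).
Proof. by rewrite fill_comp. Qed.

Lemma hole_comp_rest C T : hole (ctx_comp C (CHole T)) = hole C.
Proof. by rewrite hole_comp cats0. Qed.

Lemma hole_rest_comp_in C T a C' H : hole_rest (ctx_comp C (CIn T a C' H)) = hole_rest C'.
Proof. by elim: C. Qed.

(** * Refutations *)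

Section Refutation.
Variable M : model At A.

(** Only parent-child edges are constrained: each [acc a] is an equivalence, so siblings are then
    related as well, and a refutation can be built child by child. *)
Inductive refuted : world M -> cs -> Prop :=
  Refuted w S : (forall f, f \in root_seq S -> ~ sat w f) ->
    (forall a T, kid S a T -> exists v, acc a w v /\ refuted v T) -> refuted w S.

Lemma refuted_root w S f : refuted w S -> f \in root_seq S -> ~ sat w f.
Proof. by case=> {}w {}S Hr _; apply: Hr. Qed.

Lemma refuted_kid w S a T : refuted w S -> kid S a T -> exists v, acc a w v /\ refuted v T.
Proof. by case=> {}w {}S _; apply. Qed.

Lemma refuted_merge w X T : refuted w (cs_merge X T) <-> refuted w X /\ refuted w T.
Proof.
split=> [R|[RX RT]].
  by split; constructor=> [f fX|a U kU];
    [apply: (refuted_root R)|apply: (refuted_kid R)|apply: (refuted_root R)|apply: (refuted_kid R)];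
    rewrite ?root_merge ?in_fsetU ?fX ?orbT //; apply/kid_merge; [left|right].
constructor=> [f|a U /kid_merge[]]; [|exact: refuted_kid RX|exact: refuted_kid RT].
by rewrite root_merge in_fsetU => /orP[]; apply: refuted_root.
Qed.

Lemma refuted_bracket w a H :
  refuted w (CS fset0 [:: (a, H)]) <->
  forall T, List.In T H -> exists v, acc a w v /\ refuted v T.
Proof.
split=> [R T TH|R]; first by apply: (refuted_kid R); apply/kid1.
by constructor=> // b T /kid1[-> TH]; apply: R.
Qed.

Lemma refuted_seq w G : refuted w (CS G [::]) <-> forall f, f \in G -> ~ sat w f.
Proof.
split=> [R f|R]; first exact: (refuted_root R).
by constructor=> // a T /kid_nil.
Qed.

(** Outside the hole the refutation is kept. Which replacement survives depends on the world reached
    at the hole, hence a list [Xs] of candidates, one for each premise. *)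
Lemma refuted_fill w C X Xs :
  (forall v, refuted v X -> exists P, List.In P Xs /\ refuted v P) ->
  refuted w (fill C X) ->
  exists P, List.In P Xs /\ refuted w (fill C P).
Proof.
move=> HX; elim: C w => [T|T a C IH H] w /= /refuted_merge[].
  by move=> /HX[P [PX RP]] RT; exists P; split=> //; apply/refuted_merge.
move=> /refuted_bracket RH RT.
have [v [wv /IH[P [PX RP]]]] := RH _ (or_introl erefl).
exists P; split=> //; apply/refuted_merge; split=> //; apply/refuted_bracket.
by move=> U [<-|UH]; [exists v|apply: RH; right].
Qed.

Lemma refuted_fill1 w C X Y :
  (forall v, refuted v X -> refuted v Y) -> refuted w (fill C X) -> refuted w (fill C Y).
Proof.
move=> XY /(@refuted_fill w C X [:: Y])[v RX|P [[<-|//]]] //.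
by exists Y; split; [left|apply: XY].
Qed.

End Refutation.

(* Multiplicities of siblings are forgotten: truth and saturation do not see
   them, but properness and the measure below do. *)
Inductive bisim : cs -> cs -> Prop :=
  Bisim S S' : root_seq S = root_seq S' ->
    (forall a T, kid S a T -> exists T', kid S' a T' /\ bisim T T') ->
    (forall a T', kid S' a T' -> exists T, kid S a T /\ bisim T T') ->
    bisim S S'.

Lemma bisim_root S S' : bisim S S' -> root_seq S = root_seq S'.
Proof. by case. Qed.

Lemma bisim_kid S S' a T :
  bisim S S' -> kid S a T -> exists T', kid S' a T' /\ bisim T T'.
Proof. by case=> {}S {}S' _ K _; apply: K. Qed.

Lemma bisim_refl S : bisim S S.
Proof.
by elim/cs_kid_ind: S => S IH; constructor=> // a T kT; exists T; split=> //; apply: IH kT.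
Qed.

Lemma bisim_sym S S' : bisim S S' -> bisim S' S.
Proof.
elim/cs_kid_ind: S S' => S IH S' E; case: E IH => {}S {}S' E K K' IH.
constructor=> // a T kT.
  by have [U [kU ?]] := K' _ _ kT; exists U; split=> //; apply: IH kU _ _.
by have [U [kU ?]] := K _ _ kT; exists U; split=> //; apply: IH kT _ _.
Qed.

Lemma bisim_trans S T U : bisim S T -> bisim T U -> bisim S U.
Proof.
elim/cs_kid_ind: S T U => S IH T U ST TU; constructor.
- by rewrite (bisim_root ST) (bisim_root TU).
- move=> a V kV; have [V' [kV' VV']] := bisim_kid ST kV.
  have [V'' [kV'' V'V'']] := bisim_kid TU kV'.
  by exists V''; split=> //; apply: IH kV _ _ VV' V'V''.
move=> a V kV; have [V' [kV' VV']] := bisim_kid (bisim_sym TU) kV.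
have [V'' [kV'' V'V'']] := bisim_kid (bisim_sym ST) kV'.
by exists V''; split=> //; apply: IH kV'' _ _ (bisim_sym V'V'') (bisim_sym VV').
Qed.

Lemma bisim_merge X X' T : bisim X X' -> bisim (cs_merge X T) (cs_merge X' T).
Proof.
move=> E; constructor.
- by rewrite !root_merge (bisim_root E).
- move=> a U /kid_merge[/(bisim_kid E)[U' [kU' ?]]|kU].
    by exists U'; split=> //; apply/kid_merge; left.
  by exists U; split; [apply/kid_merge; right|apply: bisim_refl].
move=> a U /kid_merge[/(bisim_kid (bisim_sym E))[U' [kU' ?]]|kU].
  by exists U'; split; [apply/kid_merge; left|apply: bisim_sym].
by exists U; split; [apply/kid_merge; right|apply: bisim_refl].
Qed.

Lemma bisim_fill C X X' : bisim X X' -> bisim (fill C X) (fill C X').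
Proof.
move=> E; elim: C => [T|T a C IH H] /=; apply: bisim_merge => //.
constructor=> // b U /kid1[-> [<-|UH]].
- by exists (fill C X'); split=> //; apply/kid1; split=> //; left.
- by exists U; split; [apply/kid1; split=> //; right|apply: bisim_refl].
- by exists (fill C X); split=> //; apply/kid1; split=> //; left.
by exists U; split; [apply/kid1; split=> //; right|apply: bisim_refl].
Qed.

Lemma cs_eq_bisim S T : cs_eq S T -> bisim S T.
Proof.
elim=> {S T}.
- exact: bisim_refl.
- by move=> S T _ /bisim_sym.
- by move=> S T U _ ST _ TU; apply: bisim_trans ST TU.
- move=> C G B B' BB'; apply: bisim_fill; constructor=> // a T [H [/= HB TH]];
    exists T; split; try exact: bisim_refl; exists H; split=> //=.
    exact: Permutation_in BB' HB.
  by apply: Permutation_in HB; apply: Permutation_sym.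
move=> C a H H' HH'; apply: bisim_fill; constructor=> // b T /kid1[-> TH];
  exists T; split; try exact: bisim_refl; apply/kid1; split=> //.
  exact: Permutation_in HH' TH.
by apply: Permutation_in TH; apply: Permutation_sym.
Qed.

(** The generators of [cs_eq] are already stated under a context, and contexts compose. *)
Lemma cs_eq_fill C S T : cs_eq S T -> cs_eq (fill C S) (fill C T).
Proof.
elim=> {S T}.
- by move=> S; apply: cs_eq_refl.
- by move=> S T _; apply: cs_eq_sym.
- by move=> S T U _ ST _; apply: cs_eq_trans.
- by move=> C' G B B' ?; rewrite -!fill_comp; apply: cs_eq_brackets.
by move=> C' a H H' ?; rewrite -!fill_comp; apply: cs_eq_hyper.
Qed.

Lemma refuted_bisim (M : model At A) (w : world M) S T : bisim S T -> refuted w S -> refuted w T.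
Proof.
elim/cs_kid_ind: S w T => S IH w T ST R; constructor.
  by move=> f; rewrite -(bisim_root ST); apply: refuted_root.
move=> a U /(bisim_kid (bisim_sym ST))[U' [kU' UU']].
have [v [wv RU']] := refuted_kid R kU'.
by exists v; split=> //; apply: (IH _ _ kU') RU'; apply: bisim_sym.
Qed.

(** * Validity as the absence of refutations *)

(** An interpretation under which no formula of [S] holds is itself a refutation, once its worlds
    are read off the labels. *)
Lemma not_refuted_valid S : (forall (M : model At A) (w : world M), ~ refuted w S) -> valid S.
Proof.
move=> noref l labl M I [Idef Iacc]; apply: NNPP => nholds.
have R T : forall x w, subtree S x = Some T -> I (l x) = Some w -> refuted w T.
  elim/cs_kid_ind: T => T IH x w ST Iw; have cx : component S x by rewrite /component ST.
  constructor=> [f fT sat_f|a U kU].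
    by apply: nholds; exists x, f, w; split; rewrite // /comp_seq ST.
  have [y [cxy SU]] := kid_child ST kU.
  have cy : component S y by rewrite /component SU.
  case E: (I (l y)) (Idef _ cy) => [v|//] _; exists v; split; last exact: IH kU _ _ SU E.
  by apply: Iacc Iw E => //; apply: Or43.
have c0 : component S [::] by [].
by case E: (I (l [::])) (Idef _ c0) => [w|//] _; apply: (noref M w); apply: R E.
Qed.

(** A refutation provides worlds one child at a time, whereas an interpretation needs one function
    on all positions; the worlds are therefore chosen simultaneously. *)
Lemma refuted_unravel (M : model At A) (w : world M) S :
  refuted w S ->
  exists J : pos -> world M,
    [/\ J [::] = w,
        forall x T, subtree S x = Some T -> refuted (J x) T
      & forall a x y, child S a x y -> acc a (J x) (J y)].
Proof.
elim/cs_kid_ind: S w => S IH w R.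
(* The condition that [k] addresses a child stays below the existential, so that a function exists
   for every [k] and choice can be applied uniformly. *)
have next k : exists J : pos -> world M, forall a T, subtree1 S k = Some (a, T) ->
    [/\ acc a w (J [::]),
        forall x U, subtree T x = Some U -> refuted (J x) U
      & forall b x y, child T b x y -> acc b (J x) (J y)].
  case E: (subtree1 S k) => [[a T]|]; last by exists (fun=> w).
  have kT : kid S a T by apply/kidP; exists k.
  have [v [wv RT]] := refuted_kid R kT; have [J [J0 JR JA]] := IH _ _ kT _ RT.
  by exists J => b U [<- <-]; split; rewrite ?J0.
pose Jk k := proj1_sig (constructive_indefinite_description _ (next k)).
have JkP k := proj2_sig (constructive_indefinite_description _ (next k)).
exists (fun x => if x is k :: x' then Jk k x' else w); split=> //.
  case=> [|k x] T; first by case=> <-.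
  rewrite subtree_cons; case E: (subtree1 S k) => [[a U]|//].
  by have [_ JR _] := JkP k a U E; apply: JR.
move=> a [|k x] y /childP[k' [T [U [-> ST TU]]]].
  by case: ST TU => <- /JkP[].
rewrite rcons_cons; move: ST; rewrite subtree_cons; case E: (subtree1 S k) => [[b V]|//] VT.
by have [_ _ JA] := JkP k b V E; apply: JA; apply/childP; exists k', T, U.
Qed.

Lemma valid_not_refuted S :
  valid S -> forall (M : model At A) (w : world M), ~ refuted w S.
Proof.
move=> valS M w /refuted_unravel[J [_ JR JA]].
(* Codes of positions are shifted by one to reserve label 0 for the root; the interpretation undoes
   this by decoding the predecessor. *)
pose l (x : pos) := if x is [::] then 0 else (choice.pickle x).+1.
have lP (x : pos) :
    (if l x is n.+1 then omap J (choice.unpickle n) else Some (J [::])) = Some (J x).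
  by case: x => [//|k x]; rewrite /l choice.pickleK.
have labl : labeling S l.
  split=> // -[|k x] [|k' y] _ _ //= [E].
  by apply: (pcan_inj (@choice.pickleK (seq (nat * nat)))).
have [|x [f [v [cx fx]]]] :=
  valS l labl M (fun n => if n is n'.+1 then omap J (choice.unpickle n') else Some (J [::])).
  split=> [x _|a x y v u _ _ xy]; first by rewrite lP.
  rewrite !lP => -[<-] [<-]; have [Er Es Et] := acc_equivalence M a.
  case: xy => [->|/JA/Es|/JA|[z [/JA/Es zx /JA zy]]] //.
  exact: Et zx zy.
rewrite lP => -[<-]; move: cx fx; rewrite /component /comp_seq.
by case E: (subtree S x) => [T|//] _ fT; apply: (refuted_root (JR _ _ E)).
Qed.

(** * Soundness of the rules *)

Lemma not_sat_Box (M : model At A) (w : world M) a f :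
  ~ sat w (Box a f) -> exists v, acc a w v /\ ~ sat v f.
Proof.
move=> nbox; apply: NNPP => nv; apply: nbox => v wv; apply: NNPP => nf.
by apply: nv; exists v.
Qed.

Lemma rule_refuted Ps S f x y (M : model At A) (w : world M) :
  rule_inst Ps S f x y -> refuted w S -> exists P, List.In P Ps /\ refuted w P.
Proof.
have sel C X Xs : (forall v : world M, refuted v X -> exists P, List.In P Xs /\ refuted v P) ->
    refuted w (fill C X) -> exists P, List.In P (map (fill C) Xs) /\ refuted w P.
  move=> HX /(refuted_fill HX)[P [PX RP]]; exists (fill C P); split=> //.
  exact: (List.in_map (fill C)).
have sel1 C X Y : (forall v : world M, refuted v X -> refuted v Y) ->
    refuted w (fill C X) -> exists P, List.In P [:: fill C Y] /\ refuted w P.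
  by move=> XY; apply: (sel C X [:: Y]) => v /XY RY; exists Y; split=> //; left.
case=> {Ps S f x y}.
- move=> C p; apply: (sel C _ [::]) => v /refuted_seq R.
  by have [] := (R (Neg p)); rewrite ?inE ?eqxx ?orbT //=; apply: (R (Pos p)); rewrite ?inE ?eqxx.
- move=> C p; apply: (sel C _ [::]) => v /refuted_seq R.
  by have [] := (R (Neg p)); rewrite ?inE ?eqxx ?orbT //=; apply: (R (Pos p)); rewrite ?inE ?eqxx.
- move=> C; apply: (sel C _ [::]) => v /refuted_seq R.
  by have [] := (R Top); rewrite ?inE ?eqxx.
- move=> C f g; apply: sel1 => v /refuted_seq R; apply/refuted_seq => h.
  have /= nfg := R (Or f g) (fset11 _).
  by rewrite !inE -orbA => /or3P[] /eqP->;
    [exact: nfg|move=> ?; apply: nfg; left|move=> ?; apply: nfg; right].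
- move=> C f g; apply: (sel C _ [:: CS [fset And f g; f] [::]; CS [fset And f g; g] [::]]) => v.
  move=> /refuted_seq R; have nfg : ~ sat v (And f g) := R (And f g) (fset11 _).
  have [sf|nsf] := classic (sat v f).
    exists (CS [fset And f g; g] [::]); split; first by right; left.
    by apply/refuted_seq => h; rewrite !inE => /orP[] /eqP-> // sg; apply: nfg; split.
  exists (CS [fset And f g; f] [::]); split; first by left.
  by apply/refuted_seq => h; rewrite !inE => /orP[] /eqP->.
(* The new sibling is placed at a world [t] witnessing the failure of the box at [u]; transitivity
   makes [t] accessible from the parent's world [v]. *)
- move=> C a f T H; apply: sel1 => v /refuted_bracket R; apply/refuted_bracket => U /= [<-|UH];
    last exact: R.
  have [u [vu /refuted_merge[/refuted_seq/(_ (Box a f) (fset11 _)) nbox _]]] :=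
    R _ (or_introl erefl).
  have [t [ut nf]] := not_sat_Box nbox.
  exists t; split; last by apply/refuted_seq => g /fset1P->.
  by have [_ _ tr] := acc_equivalence M a; apply: tr vu ut.
- move=> C a f H; apply: sel1 => v R; constructor=> [g|b T]; first exact: (refuted_root R).
  case/kid1=> -> [<-|TH]; last by apply: (refuted_kid R); apply/kid1.
  have nbox := refuted_root R (fset11 _).
  have [t [ut nf]] := not_sat_Box nbox.
  by exists t; split=> //; apply/refuted_seq => g /fset1P->.
- move=> C a f _; apply: sel1 => v R; constructor=> [g|b T]; first exact: (refuted_root R).
  case/kid1=> -> [<-|//].
  have nbox := refuted_root R (fset11 _).
  have [t [ut nf]] := not_sat_Box nbox.
  by exists t; split=> //; apply/refuted_seq => g /fset1P->.
- move=> C a f T U H; apply: sel1 => v /refuted_bracket R; apply/refuted_bracket => V /=.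
  have [u [vu RT]] := R _ (or_introl erefl).
  case=> [<-|[<-|VH]]; [by exists u| |by apply: R; right; right].
  have [t [vt RU]] := R U (or_intror (or_introl erefl)).
  have /refuted_merge[/refuted_seq/(_ (Dia a f) (fset11 _)) ndia _] := RT.
  exists t; split=> //; apply/refuted_merge; split=> //; apply/refuted_seq => g /fset1P-> sf.
  apply: ndia; exists t; split=> //.
  by have [_ sy tr] := acc_equivalence M a; apply: tr vt; apply: sy.
- move=> C a f T H; apply: sel1 => v R; constructor=> [g|b V]; first exact: (refuted_root R).
  have ndia := refuted_root R (fset11 _).
  case/kid1=> -> [<-|VH]; last by apply: (refuted_kid R); apply/kid1; split=> //; right.
  have [|t [vt RT]] := refuted_kid (a := a) (T := T) R; first by apply/kid1; split=> //; left.
  exists t; split=> //; apply/refuted_merge; split=> //; apply/refuted_seq => g /fset1P-> sf.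
  by apply: ndia; exists t.
- move=> C a f; apply: sel1 => v /refuted_seq R; apply/refuted_seq => g.
  have ndia := R _ (fset11 _).
  rewrite !inE => /orP[] /eqP-> // sf; apply: ndia; exists v; split=> //.
  by have [rf _ _] := acc_equivalence M a; apply: rf.
move=> C a f T U H; apply: sel1 => v /refuted_merge[R RT].
apply/refuted_merge; split=> //; apply/refuted_merge; split=> //;
  apply/refuted_seq => g /fset1P-> sf.
have /refuted_bracket/(_ _ (or_introl erefl))[u [vu]] := R.
case/refuted_merge=> /refuted_seq/(_ (Dia a f) (fset11 _)) ndia _.
by apply: ndia; exists v; split=> //; have [_ sy _] := acc_equivalence M a; apply: sy.
Qed.

(** The predicate [ok] only discards rule instances, so one argument covers both calculi. *)
Lemma derivable_not_refuted ok S :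
  derivable ok S -> forall (M : model At A) (w : world M), ~ refuted w S.
Proof.
elim=> {S} [Ps S f x y r _ _ _ _ IH M w R|S T ST _ IH M w R].
  by have [P [PPs RP]] := rule_refuted r R; apply: IH PPs _ _ RP.
by apply: (IH M w); apply: refuted_bisim R; apply: bisim_sym; apply: cs_eq_bisim.
Qed.

Lemma derivable_weaken (ok ok' : cs -> form -> pos -> pos -> Prop) S :
  (forall S f x y, ok S f x y -> ok' S f x y) -> derivable ok S -> derivable ok' S.
Proof.
move=> sub; elim=> {S} [Ps S f x y r o pS pPs _ IH|S T ST _ IH].
  by apply: (D_rule r) => //; apply: sub.
exact: D_eq ST IH.
Qed.

(** * Properness *)

(* Properness of a cross-sequent occurring in a bracket of agent a, for
   [o = Some a], or at the root, for [o = None]. *)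
Inductive proper_under : option A -> cs -> Prop :=
  ProperUnder o S : (forall p, List.In p (brackets S) -> 0 < size p.2) ->
    uniq [seq p.1 | p <- brackets S] ->
    (forall a, o = Some a -> a \notin [seq p.1 | p <- brackets S]) ->
    (forall a T, kid S a T -> proper_under (Some a) T) -> proper_under o S.

Lemma proper_underP o S : proper_under o S <->
  [/\ forall p, List.In p (brackets S) -> 0 < size p.2,
      uniq [seq p.1 | p <- brackets S],
      forall a, o = Some a -> a \notin [seq p.1 | p <- brackets S]
    & forall a T, kid S a T -> proper_under (Some a) T].
Proof. by split=> [[]|[]]. Qed.

Lemma proper_under_kid o S a T : proper_under o S -> kid S a T -> proper_under (Some a) T.
Proof. by case=> {}o {}S _ _ _; apply. Qed.

Lemma agentP B a :
  reflect (exists H, List.In (a, H) B) (a \in [seq p.1 | p <- B]).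
Proof.
elim: B => [|[b H] B IH] /=; first by constructor=> -[].
rewrite inE; apply: (iffP orP) => [[/eqP->|/IH[H' ?]]|[H' [[-> _]|?]]].
- by exists H; left.
- by exists H'; right.
- by left.
by right; apply/IH; exists H'.
Qed.

Lemma bracket_kid S a H :
  List.In (a, H) (brackets S) -> 0 < size H -> exists T, kid S a T.
Proof. by case: H => // T H ? _; exists T, (T :: H); split=> //; left. Qed.

Lemma all_In (I : Type) (p : pred I) s : all p s <-> forall v, List.In v s -> p v.
Proof.
elim: s => [|u s IH] //=; split=> [/andP[pu /IH ps] v [<-|/ps]|p_] //.
by rewrite p_ /=; [apply/IH => v ?; apply: p_; right|left].
Qed.

Lemma proper_under_subtree o S x T : proper_under o S -> subtree S x = Some T ->
  exists o', proper_under o' T.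
Proof.
elim: x o S => [|k x IH] o S pS; first by case=> <-; exists o.
rewrite subtree_cons; case E: (subtree1 S k) => [[a U]|//].
have kU : kid S a U by apply/kidP; exists k.
exact: IH (proper_under_kid pS kU).
Qed.

Lemma proper_under_cs o S : proper_under o S -> proper_cs S.
Proof.
move=> pS; split.
- move=> x T /(proper_under_subtree pS)[o' /proper_underP[ne _ _ _]]; exact/all_In.
- by move=> x T /(proper_under_subtree pS)[o' /proper_underP[]].
move=> a x y z /child_subtree[T [U [ST SU kU]]] /child_subtree[U' [V [SU' _ [H [UB _]]]]].
move: SU'; rewrite SU => -[E]; subst U'.
have [o' pT] := proper_under_subtree pS ST; have pU := proper_under_kid pT kU.
have /proper_underP[_ _ na _] := pU.
by have /agentP[] := na a erefl; exists H.
Qed.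

Lemma proper_cs_under S : proper_cs S -> proper_under None S.
Proof.
suff E o : (forall a, o = Some a -> a \notin [seq p.1 | p <- brackets S]) ->
    proper_cs S -> proper_under o S by apply: E.
elim/cs_kid_ind: S o => S IH o no [ne un na]; apply/proper_underP; split; last 1 first.
- move=> a T kT; have /kidP[k Sk] := kT.
  have Sx x U : subtree T x = Some U -> subtree S (k :: x) = Some U by rewrite subtree_cons Sk.
  apply: (IH _ _ kT) => [_ [<-]|].
    (* A second [a]-bracket directly inside an [a]-bracket would be nonempty, and one of its members
       would make an [a]-child an [a]-parent. *)
    apply/agentP => -[H TH].
    have /(bracket_kid TH)[U kU] : 0 < size H.
      by have /all_In/(_ _ TH) := ne [:: k] T (Sx [::] T erefl).
    have [y [cy _]] := kid_child (Sx [::] T erefl) kU.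
    by apply: (na a [::] [:: k] y) cy; apply/childP; exists k, S, T.
  split=> [x U /Sx/ne //|x U /Sx/un //|b x y z xy yz].
  by apply: (na b (k :: x) (k :: y) (k :: z)); apply: child_cons Sk _.
- by apply/all_In; apply: (ne [::]).
- exact: (un [::]).
exact: no.
Qed.

Fixpoint hole_agent (o : option A) C : option A :=
  if C is CIn _ a C' _ then hole_agent (Some a) C' else o.

(** Properness is local: of the surroundings of the hole, only the agent of the innermost enclosing
    bracket matters, which is what [hole_agent] computes. *)
Lemma proper_under_fill o C X X' :
  (proper_under (hole_agent o C) (cs_merge X (hole_rest C)) ->
    proper_under (hole_agent o C) (cs_merge X' (hole_rest C))) ->
  proper_under o (fill C X) -> proper_under o (fill C X').
Proof.
elim: C o => [//|T a C IH H] o /= XX' pS; have pX : proper_under (Some a) (fill C X').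
  by apply: IH XX' _; apply: proper_under_kid pS _; exists (fill C X :: H); split; left.
have /proper_underP[ne un na kS] := pS.
apply/proper_underP; split.
- by move=> p [<- //|TB]; apply: ne; right.
- exact: un.
- exact: na.
move=> b U [H' [/= [[<- <-]|HB] UH']]; last by apply: kS; exists H'; split=> //; right.
case: UH' => [<- //|UH]; apply: kS; exists (fill C X :: H).
by split; [left|right].
Qed.

Lemma Permutation_map_uniq (I : Type) (J : eqType) (h : I -> J) s s' :
  Permutation s s' -> uniq [seq h v | v <- s] = uniq [seq h v | v <- s'].
Proof.
move=> ss'; suff: perm_eq [seq h v | v <- s] [seq h v | v <- s'] by apply: perm_uniq.
elim: ss' => {s s'} [|u s s' _ IH|u v s|s t u _ st _ tu] /=.
- by [].
- by rewrite perm_cons.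
- by apply/permP => p /=; rewrite addnCA.
exact: perm_trans st tu.
Qed.

Lemma proper_under_perm o G B B' : Permutation B B' -> proper_under o (CS G B) ->
  proper_under o (CS G B').
Proof.
move=> BB' /proper_underP[/= ne un na kS]; have B'B := Permutation_sym BB'.
apply/proper_underP; split=> /=.
- by move=> p /(Permutation_in _ B'B)/ne.
- by rewrite -(Permutation_map_uniq _ BB').
- move=> a /na nB; apply/agentP => -[H /(Permutation_in _ B'B) HB]; case/agentP: nB.
  by exists H.
by move=> a T [H [/(Permutation_in _ B'B) HB TH]]; apply: kS; exists H.
Qed.

Lemma proper_under_hyper o G a H H' B :
  Permutation H H' -> proper_under o (CS G ((a, H) :: B)) -> proper_under o (CS G ((a, H') :: B)).
Proof.
move=> HH' /proper_underP[/= ne un na kS]; have H'H := Permutation_sym HH'.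
apply/proper_underP; split=> /=.
- move=> p [<-|bB]; last by apply: ne; right.
  by move: (ne _ (or_introl erefl)); rewrite /= -![size _]/(length _) (Permutation_length HH').
- exact: un.
- exact: na.
move=> b T [H0 [/= [[<- <-]|H0B] TH]]; apply: kS; last by exists H0; split=> //; right.
by exists H; split; [left|apply: Permutation_in TH].
Qed.

Lemma proper_under_cs_eq S T : cs_eq S T -> forall o, proper_under o S <-> proper_under o T.
Proof.
elim=> {S T}.
- by move=> S o; split.
- by move=> S T _ IH o; split=> /IH.
- by move=> S T U _ ST _ TU o; rewrite ST.
- move=> C G B B' BB' o; split; apply: proper_under_fill; apply: proper_under_perm;
    apply: Permutation_app_tail => //.
  exact: Permutation_sym.
move=> C a H H' HH' o; split; apply: proper_under_fill; apply: proper_under_hyper => //.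
exact: Permutation_sym.
Qed.

(** * Corresponding positions *)

(* [along S S' x x']: the positions x and x' correspond under a bisimulation. *)
Inductive along : cs -> cs -> pos -> pos -> Prop :=
  | Along_nil S S' : bisim S S' -> along S S' [::] [::]
  | Along_cons S S' k k' a T T' x x' : bisim S S' ->
      subtree1 S k = Some (a, T) -> subtree1 S' k' = Some (a, T') ->
      along T T' x x' -> along S S' (k :: x) (k' :: x').

Lemma along_sym S S' x x' : along S S' x x' -> along S' S x' x.
Proof.
elim=> {S S' x x'} [S S'|S S' k k' a T T' x x'] /bisim_sym; first exact: Along_nil.
by move=> S'S Sk S'k' _; apply: Along_cons S'k' Sk.
Qed.

Lemma along_subtree S S' x x' : along S S' x x' ->
  exists T T', [/\ subtree S x = Some T, subtree S' x' = Some T' & bisim T T'].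
Proof.
elim=> {S S' x x'} [S S' SS'|S S' k k' a T T' x x' _ Sk S'k' _]; first by exists S, S'.
by rewrite !subtree_cons Sk S'k'.
Qed.

Lemma along_total S S' x : bisim S S' -> component S x -> exists x', along S S' x x'.
Proof.
elim: x S S' => [|k x IH] S S' SS'; first by exists [::]; apply: Along_nil.
rewrite /component subtree_cons; case E: (subtree1 S k) => [[a T]|//].
have kT : kid S a T by apply/kidP; exists k.
have [T' [/kidP[k' S'k'] TT']] := bisim_kid SS' kT.
by move=> /(IH _ _ TT')[x' xx']; exists (k' :: x'); apply: Along_cons E S'k' xx'.
Qed.

Lemma along_rcons S S' x x' T T' k k' a U U' :
  along S S' x x' -> subtree S x = Some T -> subtree S' x' = Some T' ->
  subtree1 T k = Some (a, U) -> subtree1 T' k' = Some (a, U') -> bisim U U' ->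
  along S S' (rcons x k) (rcons x' k').
Proof.
move=> xx' + + Tk T'k' UU';
  elim: xx' => {S S' x x'} [S S' SS'|S S' l l' b V V' x x' SS' Sl S'l' _ IH].
  move=> [ST] [S'T']; subst T T'; apply: Along_cons SS' Tk T'k' _; exact: Along_nil.
rewrite !subtree_cons Sl S'l' => VT V'T'; apply: Along_cons SS' Sl S'l' _; exact: IH.
Qed.

Lemma along_child S S' x x' a y :
  along S S' x x' -> child S a x y -> exists y', child S' a x' y' /\ along S S' y y'.
Proof.
move=> xx' /childP[k [T [U [-> ST TU]]]]; have [V [T' [SV S'T' TT']]] := along_subtree xx'.
move: SV; rewrite ST => -[EV]; subst V.
have kU : kid T a U by apply/kidP; exists k.
have [U' [/kidP[k' T'k'] UU']] := bisim_kid TT' kU.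
exists (rcons x' k'); split; first by apply/childP; exists k', T', U'.
exact: along_rcons xx' ST S'T' TU T'k' UU'.
Qed.

Lemma along_nilP S S' y' : along S S' [::] y' -> y' = [::].
Proof. by move=> H; inversion H. Qed.

Lemma along_consP S S' k x y' : along S S' (k :: x) y' ->
  exists k' x' a T T', [/\ y' = k' :: x', bisim S S', subtree1 S k = Some (a, T),
    subtree1 S' k' = Some (a, T') & along T T' x x'].
Proof.
by move=> H; inversion H as [|? ? ? k' a T T' ? x']; subst; exists k', x', a, T, T'.
Qed.

(** A bisimulation of subtrees only looks downwards. Parents correspond because [along] matches
    whole paths step by step, with equal agents. *)
Lemma along_parent S S' y y' a x :
  along S S' y y' -> child S a x y -> exists x', child S' a x' y' /\ along S S' x x'.
Proof.
move=> yy' /childP[k [T [U [Ey ST TU]]]]; subst y.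
elim: x S S' y' yy' ST => [|l x IH] S S' y' /along_consP[k' [x' [b [V [V' [-> SS' Sk S'k' xx']]]]]].
  move=> [ST]; subst T; move: Sk; rewrite TU => -[Eb EV]; subst b V.
  rewrite (along_nilP xx'); exists [::]; split; last exact: Along_nil.
  by apply/childP; exists k', S', V'.
rewrite subtree_cons Sk => VT; have [z [cz xz]] := IH _ _ _ xx' VT.
exists (k' :: z); split; first exact: child_cons S'k' cz.
exact: Along_cons SS' Sk S'k' xz.
Qed.

Lemma along_cluster S S' x x' a y :
  along S S' x x' -> cluster S a x y -> exists y', cluster S' a x' y' /\ along S S' y y'.
Proof.
move=> xx' [->|/(along_parent xx')[y' [? ?]]|/(along_child xx')[y' [? ?]]|].
- by exists x'; split=> //; apply: Or41.
- by exists y'; split=> //; apply: Or42.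
- by exists y'; split=> //; apply: Or43.
case=> z [/(along_parent xx')[z' [zx' zz']] /(along_child zz')[y' [zy' yy']]].
by exists y'; split=> //; apply: Or44; exists z'.
Qed.

Lemma along_comp_seq S S' x x' : along S S' x x' -> comp_seq S x = comp_seq S' x'.
Proof.
by move=> /along_subtree[T [T' [ST S'T' TT']]]; rewrite /comp_seq ST S'T' (bisim_root TT').
Qed.

(** Clusters are reached by parent and child steps, which [along] transports; a box sends its
    witness forwards, a diamond pulls each cluster member back. *)
Lemma along_saturated S S' x x' f : along S S' x x' -> saturated S x f -> saturated S' x' f.
Proof.
move=> xx'; case: f => //= [p|p|f g|f g|a f|a f]; rewrite ?(along_comp_seq xx') //.
  case=> y [/(along_cluster xx')[y' [xy' yy']]]; rewrite (along_comp_seq yy') => fy.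
  by exists y'.
move=> sat_f y' /(along_cluster (along_sym xx'))[y [xy y'y]].
by rewrite (along_comp_seq y'y); apply: sat_f.
Qed.

Lemma along_unsaturated S S' x x' f :
  along S S' x x' -> unsaturated S x f -> unsaturated S' x' f.
Proof.
move=> xx' [fx nsat]; split; first by rewrite -(along_comp_seq xx').
by move=> /(along_saturated (along_sym xx')).
Qed.

Lemma comp_seqP S x f : f \in comp_seq S x -> exists T, subtree S x = Some T /\ f \in root_seq T.
Proof. by rewrite /comp_seq; case: (subtree S x) => [T|//] fT; exists T. Qed.

(** * Priority, and moving components to the front *)

Definition minimal S f := forall z g, unsaturated S z g -> priority f <= priority g.

Lemma minimal_bisim S S' f : bisim S S' -> minimal S f -> minimal S' f.
Proof.
move=> SS' mf z' g uz'; have [T [S'T _]] := comp_seqP (proj1 uz').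
have [|z z'z] := along_total (x := z') (bisim_sym SS'); first by rewrite /component S'T.
exact: mf (along_unsaturated z'z uz').
Qed.

Lemma minimal_exists S z g : unsaturated S z g ->
  exists x f, unsaturated S x f /\ minimal S f.
Proof.
have [n] := ubnP (priority g); elim: n g z => [//|n IH] g z; rewrite ltnS => le_g ug.
have [[z' [g' [ug' lt]]]|nex] :=
  classic (exists z' g', unsaturated S z' g' /\ priority g' < priority g).
  by apply: (IH g' z') ug'; apply: leq_trans lt _.
exists z, g; split=> // z' g' ug'; rewrite leqNgt; apply/negP => lt; apply: nex.
by exists z', g'.
Qed.

Lemma bracket_front S a H H' : List.In (a, H) (brackets S) -> Permutation H H' ->
  exists B, cs_eq S (CS (root_seq S) ((a, H') :: B)).
Proof.
case: S => G B0 /= HB HH'; have [B1 [B2 EB]] := List.in_split _ _ HB; subst B0.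
have BB : Permutation (B1 ++ (a, H) :: B2) ((a, H) :: B1 ++ B2).
  by apply: Permutation_sym; apply: Permutation_middle.
exists (B1 ++ B2).
have := @cs_eq_brackets At A (CHole (CS fset0 [::])) G _ _ BB; rewrite /= !cs_merge0 => E.
apply: cs_eq_trans E _.
have := @cs_eq_hyper At A (CHole (CS G (B1 ++ B2))) a _ _ HH'.
by rewrite /= /cs_merge /= fset0U.
Qed.

Lemma kid_front S a T : kid S a T ->
  exists H B, cs_eq S (CS (root_seq S) ((a, T :: H) :: B)).
Proof.
case=> H [HB TH]; have [H1 [H2 EH]] := List.in_split _ _ TH; subst H.
exists (H1 ++ H2); apply: bracket_front HB _.
by apply: Permutation_sym; apply: Permutation_middle.
Qed.

Lemma bracket_uniq B a H H' : uniq [seq p.1 | p <- B] ->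
  List.In (a, H) B -> List.In (a, H') B -> H = H'.
Proof.
elim: B => [//|[b H0] B IH] /= /andP[nb un].
case=> [[Eb EH]|HB] [[Eb' EH']|H'B]; last exact: IH.
- by rewrite -EH EH'.
- by case/agentP: nb; exists H'; rewrite Eb.
by case/agentP: nb; exists H; rewrite Eb'.
Qed.

(** Prepares [R_dia_in], whose two active siblings have indices 0 and 1. As there is a single
    [a]-bracket, both lie in the same list, and [T <> U] ensures that [U] is still there after [T]
    has been taken out. *)
Lemma kid_front2 S a T U : uniq [seq p.1 | p <- brackets S] ->
  kid S a T -> kid S a U -> T <> U ->
  exists H B, cs_eq S (CS (root_seq S) ((a, T :: U :: H) :: B)).
Proof.
move=> un [H [HB TH]] [H' [H'B UH]] TU.
rewrite -{H' H'B}(bracket_uniq un HB H'B) in UH.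
have [H1 [H2 EH]] := List.in_split _ _ TH.
have HT : Permutation H (T :: H1 ++ H2).
  by rewrite EH; apply: Permutation_sym; apply: Permutation_middle.
have [//|UH'] := Permutation_in _ HT UH.
have [H3 [H4 EH']] := List.in_split _ _ UH'.
exists (H3 ++ H4); apply: bracket_front HB _; apply: Permutation_trans HT _.
by rewrite EH'; apply: perm_skip; apply: Permutation_sym; apply: Permutation_middle.
Qed.

(** The hole of a context is always reached by steps [(0, 0)], so every bracket on the path to [x]
    is reordered. The empty [hole_rest] says that the filler is the whole subtree there. *)
Lemma bring_front S x T T' : subtree S x = Some T -> cs_eq T T' ->
  exists C, [/\ hole_rest C = CS fset0 [::], cs_eq S (fill C T') & along S (fill C T') x (hole C)].
Proof.
move=> + TT'; elim: x S => [|k x IH] S.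
  move=> [->]; exists (CHole (CS fset0 [::])); rewrite /= cs_merge0; split=> //.
  by apply: Along_nil; apply: cs_eq_bisim.
rewrite subtree_cons; case Sk: (subtree1 S k) => [[a U]|//] /IH[C [hC UC xC]].
have kU : kid S a U by apply/kidP; exists k.
have [H [B SE]] := kid_front kU.
have SS' : cs_eq S (fill (CIn (CS (root_seq S) B) a C H) T').
  apply: cs_eq_trans SE _.
  have := cs_eq_fill (CIn (CS (root_seq S) B) a (CHole (CS fset0 [::])) H) UC.
  by rewrite /= !cs_merge0 {1}/cs_merge /= fset0U.
exists (CIn (CS (root_seq S) B) a C H); split=> //.
by apply: Along_cons Sk _ xC => //; apply: cs_eq_bisim.
Qed.

(** * Termination measure *)

Fixpoint modal_depth f : nat :=
  match f with
  | And f g | Or f g => maxn (modal_depth f) (modal_depth g)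
  | Box _ f | Dia _ f => (modal_depth f).+1
  | _ => 0
  end.

Definition children f : seq form :=
  match f with
  | And f g | Or f g => [:: f; g]
  | Box _ f | Dia _ f => [:: f]
  | _ => [::]
  end.

Fixpoint subforms f : seq form :=
  f :: match f with
       | And f g | Or f g => subforms f ++ subforms g
       | Box _ f | Dia _ f => subforms f
       | _ => [::]
       end.

Definition subform_closed (F : seq form) := forall f g, f \in F -> g \in children f -> g \in F.

Lemma subforms_self f : f \in subforms f.
Proof. by case: f => *; rewrite mem_head. Qed.

Lemma subforms_closed f : subform_closed (subforms f).
Proof.
elim: f => [||p|p|f IHf g IHg|f IHf g IHg|a f IHf|a f IHf] h k;
  rewrite /= ?inE ?mem_cat ?orbF.
1-4: by move=> /eqP->.
1-2: case/or3P=> [/eqP->|hf|hg]; rewrite ?inE.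
- by case/orP=> /eqP->; rewrite subforms_self ?orbT.
- by move/(IHf _ _ hf)->; rewrite orbT.
- by move/(IHg _ _ hg)->; rewrite !orbT.
- by case/orP=> /eqP->; rewrite subforms_self ?orbT.
- by move/(IHf _ _ hf)->; rewrite orbT.
- by move/(IHg _ _ hg)->; rewrite !orbT.
- by case/orP=> [/eqP->|hf]; [rewrite inE => /eqP->; rewrite subforms_self orbT|
    move/(IHf _ _ hf)->; rewrite orbT].
by case/orP=> [/eqP->|hf]; [rewrite inE => /eqP->; rewrite subforms_self orbT|
    move/(IHf _ _ hf)->; rewrite orbT].
Qed.

Section Measure.
Variable F : seq form.
Local Open Scope nat_scope.

(** The number is the budget for modal depth, and it falls by one per level. A scope sent to a
    parent, a sibling or a child has lost a modality, so it fits the budget of its new place. *)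
Inductive bounded : nat -> cs -> Prop :=
  Bounded d S : (forall f, f \in root_seq S -> f \in F /\ modal_depth f <= d) ->
    (forall a T, kid S a T -> bounded d.-1 T) -> bounded d S.

Lemma bounded_root d S f : bounded d S -> f \in root_seq S -> f \in F /\ modal_depth f <= d.
Proof. by case=> {}d {}S + _; apply. Qed.

Lemma bounded_kid d S a T : bounded d S -> kid S a T -> bounded d.-1 T.
Proof. by case=> {}d {}S _; apply. Qed.

Lemma bounded_subtree d S x T : bounded d S -> subtree S x = Some T -> bounded (d - size x) T.
Proof.
elim: x d S => [|k x IH] d S wS; first by rewrite subn0; case=> <-.
rewrite subtree_cons; case Sk: (subtree1 S k) => [[a U]|//].
have kU : kid S a U by apply/kidP; exists k.
by rewrite /= -[_.+1]add1n subnDA subn1; apply: IH (bounded_kid wS kU).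
Qed.

Lemma bounded_bisim d S S' : bisim S S' -> bounded d S -> bounded d S'.
Proof.
elim/cs_kid_ind: S d S' => S IH d S' SS' wS; constructor.
  by move=> f; rewrite -(bisim_root SS'); apply: bounded_root.
move=> a T' /(bisim_kid (bisim_sym SS'))[T [kT T'T]].
by apply: (IH _ _ kT) (bounded_kid wS kT); apply: bisim_sym.
Qed.

Lemma bounded_fill d C X X' :
  (bounded (d - size (hole C)) (cs_merge X (hole_rest C)) ->
   bounded (d - size (hole C)) (cs_merge X' (hole_rest C))) ->
  bounded d (fill C X) -> bounded d (fill C X').
Proof.
elim: C d => [T|T a C IH H] d /=; first by rewrite subn0.
rewrite -[_.+1]add1n subnDA subn1 => /IH{}IH wS; constructor;
  first by move=> f; apply: bounded_root wS.
move=> b U /kid_merge[/kid1[_ [<-|UH]]|kU].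
- by apply: IH; apply: bounded_kid wS _; apply/kid_merge; left; apply/kid1; split; last left.
- by apply: bounded_kid wS _; apply/kid_merge; left; apply/kid1; split; last right.
by apply: bounded_kid wS _; apply/kid_merge; right; apply: kU.
Qed.

(** Absence from the whole [a]-cluster whose parent is the root of [S]; boolean, so that it can be
    counted. *)
Definition missing a S f : bool :=
  (f \notin root_seq S) &&
  all (fun p => (p.1 == a) ==> all (fun T => f \notin root_seq T) p.2) (brackets S).

Lemma missingP a S f : missing a S f <->
  f \notin root_seq S /\ forall T, kid S a T -> f \notin root_seq T.
Proof.
rewrite /missing; split=> [/andP[-> /all_In p_]|[-> k_]].
  split=> // T [H [HB TH]]; move: (p_ _ HB); rewrite /= eqxx /= => /all_In; exact.
apply/all_In => -[b H] /= HB; apply/implyP => /eqP Eb; subst b.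
by apply/all_In => T TH; apply: k_; exists H.
Qed.

(* One more than the bound on the measure of a component [leaf f] of budget
   d - 1: see [measure_leaf]. *)
Fixpoint weight d : nat :=
  if d is d'.+1 then (size F + #|A| * (weight d' * size F)).+1 else 0.

(** Each component contributes the formulas it lacks and, as potential parent for each agent, the
    weighted number of formulas its cluster lacks. Clusters weigh nothing at budget 0, where no box
    fits that could create a child. *)
Fixpoint measure d S {struct S} : nat :=
  let: CS G B := S in
  count (fun f => f \notin G) F + \sum_(a : A) weight d * count (missing a (CS G B)) F
  + sumn [seq sumn [seq measure d.-1 T | T <- p.2] | p <- B].

Definition kidsum d S := sumn [seq sumn [seq measure d.-1 T | T <- p.2] | p <- brackets S].

Arguments measure : simpl never.

Lemma measureE d S : measure d S =
  count (fun f => f \notin root_seq S) F + \sum_(a : A) weight d * count (missing a S) F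
  + kidsum d S.
Proof. by case: S. Qed.

Lemma count_le (p q : pred form) : subpred p q -> count p F <= count q F.
Proof. by move=> pq; apply: sub_count. Qed.

Lemma count_lt (p q : pred form) f :
  subpred p q -> f \in F -> q f -> ~~ p f -> count p F < count q F.
Proof.
move=> pq; elim: F => [//|g s IH]; rewrite inE /= => /orP[/eqP<-|fs] qf npf.
  by rewrite qf (negbTE npf) ltnS add0n; apply: sub_count.
by rewrite -addnS leq_add ?IH //; case: (p g) (pq g) => // ->.
Qed.

(** A fresh component lacks at most [size F] formulas itself, and each of its [#|A|] clusters lacks
    at most [size F], at weight [weight d] each. *)
Lemma measure_leaf d f : measure d (leaf f) < weight d.+1.
Proof.
rewrite measureE /kidsum /= addn0 ltnS leq_add ?count_size //.
rewrite -big_distrr /= mulnCA leq_mul2l; apply/orP; right.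
by rewrite -sum_nat_const; apply: leq_sum => a _; apply: count_size.
Qed.

Lemma sumn_Permutation (I : Type) (h : I -> nat) s s' :
  Permutation s s' -> sumn [seq h v | v <- s] = sumn [seq h v | v <- s'].
Proof.
elim=> //= [u {}s {}s' _ ->//|u v {}s|{}s t u _ -> _ ->//].
by rewrite addnCA.
Qed.

(** The slack [c] lets one statement serve twice: 0 gives invariance under [cs_eq], 1 gives strict
    decrease. *)
Lemma measure_mono c d S S' :
  {subset root_seq S <= root_seq S'} ->
  (forall a f, missing a S' f -> missing a S f) ->
  kidsum d S' + c <= kidsum d S -> measure d S' + c <= measure d S.
Proof.
move=> sub mis kds; rewrite !measureE -addnA leq_add // leq_add //.
  by apply: count_le => f; apply: contra; apply: sub.
by apply: leq_sum => a _; rewrite leq_mul2l count_le ?orbT // => f; apply: mis.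
Qed.

(** A drop at the hole survives in every ancestor, because missing counts there cannot rise when the
    root sequent of a child grows. Hence the inclusion of roots is carried through the same
    induction. *)
Lemma measure_fill c d C X X' :
  {subset root_seq (cs_merge X (hole_rest C)) <= root_seq (cs_merge X' (hole_rest C))} ->
  measure (d - size (hole C)) (cs_merge X' (hole_rest C)) + c <=
    measure (d - size (hole C)) (cs_merge X (hole_rest C)) ->
  {subset root_seq (fill C X) <= root_seq (fill C X')} /\
  measure d (fill C X') + c <= measure d (fill C X).
Proof.
elim: C d => [T|T a C IH H] d /=; first by rewrite subn0.
rewrite -[_.+1]add1n subnDA subn1 => XX' /(IH _ XX')[sub le]; split=> //.
apply: (@measure_mono c).
- by [].
- move=> b f /missingP[nf kf]; apply/missingP; split=> // U /kid_merge[/kid1[Eb UH]|kU]; last first.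
    by apply: kf; apply/kid_merge; right.
  have kX' V : List.In V (fill C X' :: H) -> f \notin root_seq V.
    by move=> VH; apply: kf; apply/kid_merge; left; apply/kid1.
  case: UH => [<-|UH]; last by apply: kX'; right.
  by have := kX' _ (or_introl erefl); apply: contra; apply: sub.
by rewrite /kidsum /= addnAC leq_add2r addnAC leq_add2r.
Qed.

Lemma measure_kids d S S' : root_seq S = root_seq S' -> (forall a T, kid S a T <-> kid S' a T) ->
  kidsum d S = kidsum d S' -> measure d S = measure d S'.
Proof.
move=> rt kd ks; have le V V' : root_seq V = root_seq V' ->
    (forall a T, kid V a T <-> kid V' a T) ->
    kidsum d V = kidsum d V' -> measure d V + 0 <= measure d V'.
  move=> rV kV sV; apply: measure_mono; rewrite ?rV ?sV ?addn0 // => a f /missingP[nf kf].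
  by apply/missingP; rewrite -rV; split=> // T /kV/kf.
by apply/eqP; rewrite eqn_leq -[X in X <= _]addn0 le //= -[X in X <= _]addn0 le // => a T;
  rewrite kd.
Qed.

Lemma measure_fill_eq d C X X' : root_seq X = root_seq X' ->
  (forall d, measure d (cs_merge X (hole_rest C)) = measure d (cs_merge X' (hole_rest C))) ->
  measure d (fill C X) = measure d (fill C X').
Proof.
move=> rX mX; apply/eqP; rewrite eqn_leq -[X in X <= _]addn0 -[X in _ && (X <= _)]addn0.
by rewrite !(proj2 (@measure_fill 0 d C _ _ _ _)) ?mX ?addn0 //= rX.
Qed.

Lemma measure_cs_eq d S T : cs_eq S T -> measure d S = measure d T.
Proof.
elim=> {S T} // [S T U _ -> _ -> //|C G B B' BB'|C a H H' HH'].
  apply: measure_fill_eq => // {}d; apply: measure_kids => //.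
    have BBr := Permutation_app_tail (brackets (hole_rest C)) BB'.
    by move=> a T; split=> -[H [/= HB TH]]; exists H; split=> //=;
      [apply: Permutation_in HB|apply: Permutation_in (Permutation_sym _) HB].
  by rewrite /kidsum /= !map_cat !sumn_cat (sumn_Permutation _ BB').
apply: measure_fill_eq => // {}d; apply: measure_kids => //; last first.
  by rewrite /kidsum /= (sumn_Permutation _ HH').
move=> b T; split=> /kid_merge[/kid1[-> TH]|kT]; apply/kid_merge; try (by right); left.
  by apply/kid1; split=> //; apply: Permutation_in TH.
by apply/kid1; split=> //; apply: Permutation_in (Permutation_sym _) TH.
Qed.

Lemma measure_add d G f X : f \in F -> f \in G -> f \notin root_seq X ->
  measure d (cs_merge (CS G [::]) X) < measure d X.
Proof.
move=> fF fG fX; rewrite !measureE /kidsum /= -addSn leq_add // -addSn leq_add //.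
  apply: (@count_lt _ _ f) => //= [g|]; last by rewrite in_fsetU fG.
  by rewrite in_fsetU; apply: contra => ->; rewrite orbT.
apply: leq_sum => a _; rewrite leq_mul2l count_le ?orbT // => g /missingP[].
by rewrite root_merge in_fsetU negb_or => /andP[_ gX] kg; apply/missingP.
Qed.

(** The cluster stops missing [f], which frees one [weight], strictly more than the new leaf
    costs. *)
Lemma measure_new d a f S S' : 0 < d -> f \in F -> root_seq S = root_seq S' ->
  (forall b T, kid S' b T <-> (b = a /\ T = leaf f) \/ kid S b T) ->
  kidsum d S' = kidsum d S + measure d.-1 (leaf f) ->
  missing a S f -> measure d S' < measure d S.
Proof.
case: d => // d _ fF rS kS ks mf;
  rewrite !measureE ks rS (addnC (kidsum _ _)) addnA -addSn leq_add //.
rewrite -addnA -addnS leq_add2l (bigD1 a) //= [X in _ <= X](bigD1 a) //=.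
have mS b g : missing b S' g -> missing b S g.
  move=> /missingP[ng kg]; apply/missingP; rewrite rS; split=> // T kT; apply: kg.
  by apply/kS; right.
have nf : ~~ missing a S' f.
  apply/negP => /missingP[_ /(_ (leaf f))]; rewrite /= !inE eqxx => kf.
  by have := kf (proj2 (kS _ _) (or_introl (conj erefl erefl))).
have lt := count_lt (mS a) fF mf nf.
rewrite addnAC addnC -addnS addnC leq_add //; last first.
  by apply: leq_sum => b _; rewrite leq_mul2l count_le ?orbT // => g; apply: mS.
(* The count for agent [a] drops by at least one, and this unit is worth [weight d.+1]. *)
apply: leq_trans (leq_mul (leqnn (weight d.+1)) lt).
by rewrite mulnS addnC -addSn leq_add2r; apply: measure_leaf.
Qed.

End Measure.

(** * A closed set of formulas and an initial budget *)

Fixpoint forms S : seq form :=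
  let: CS G B := S in G ++ flatten [seq flatten [seq forms T | T <- p.2] | p <- B].

(** A generous bound: the sum of all modal depths, plus one per component to pay for the loss of one
    unit at each level. *)
Fixpoint budget S : nat :=
  let: CS G B := S in
  (sumn [seq modal_depth f | f <- G] + sumn [seq sumn [seq budget T | T <- p.2] | p <- B]).+1.

Lemma bounded_budget F d S : {subset forms S <= F} -> budget S <= d -> bounded F d S.
Proof.
have In_flat (I : Type) (J : eqType) (h : I -> seq J) v s j :
    List.In v s -> j \in h v -> j \in flatten [seq h u | u <- s].
  elim: s => [//|u s IH] /= [->|vs] jv; rewrite mem_cat ?jv //.
  by rewrite IH ?orbT.
have In_sum (I : Type) (h : I -> nat) v s : List.In v s -> h v <= sumn [seq h u | u <- s].
  elim: s => [//|u s IH] /= [->|vs]; first exact: leq_addr.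
  by apply: leq_trans (IH vs) _; apply: leq_addl.
elim/cs_kid_ind: S d => -[G B] IH d /= sub bud; constructor=> [f /= fG|a T kT].
  split; first by apply: sub; rewrite mem_cat fG.
  apply: leq_trans bud; rewrite ltnW // ltnS; apply: leq_trans (leq_addr _ _).
  have : f \in (G : seq form) by [].
  elim: (G : seq form) => [//|g s IHs]; rewrite inE /= => /orP[/eqP->|/IHs]; first exact: leq_addr.
  by move/leq_trans; apply; apply: leq_addl.
have [H [/= HB TH]] := kT; apply: (IH _ _ kT).
  move=> f fT; apply: sub; rewrite mem_cat; apply/orP; right.
  apply: (In_flat _ _ _ (a, H)) => //; exact: (In_flat _ _ _ T).
rewrite -ltnS; case: d bud => // d; rewrite !ltnS; apply: leq_trans.
apply: leq_trans (leq_addl _ _); apply: leq_trans (In_sum _ _ (a, H) _ HB) => /=.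
exact: In_sum.
Qed.

Lemma bounded_exists S : exists F d, subform_closed F /\ bounded F d S.
Proof.
exists (flatten [seq subforms f | f <- forms S]), (budget S); split.
  move=> f g /flatten_mapP[h hS fh] gf; apply/flatten_mapP; exists h => //.
  exact: subforms_closed gf.
apply: bounded_budget => // f fS; apply/flatten_mapP; exists f => //; exact: subforms_self.
Qed.

Lemma along_size S S' x x' : along S S' x x' -> size x = size x'.
Proof. by elim=> //= {}S {}S' k k' a T T' y y' _ _ _ _ ->. Qed.

(** * The countermodel *)

(** Properness serves transitivity: no component is both an [a]-child and an [a]-parent, so two
    [a]-edges never form a chain, and as parents are unique, clusters cannot overlap. *)
Lemma cluster_equivalence S a : proper_cs S -> Equivalence (cluster S a).
Proof.
move=> [_ _ np]; split.
- by move=> x; apply: Or41.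
- move=> x y [->|?|?|[z [? ?]]]; [exact: Or41|exact: Or43|exact: Or42|].
  by apply: Or44; exists z.
have parent_child x y z : child S a y x -> cluster S a y z -> cluster S a x z.
  move=> yx [->|zy|yz|[u [uy uz]]]; [exact: Or42| | |].
  - by case: (np _ _ _ _ zy yx).
  - by apply: Or44; exists y.
  by case: (np _ _ _ _ uy yx).
move=> x y z [->//|yx|xy|[u [ux uy]]] yz.
- exact: parent_child yx yz.
- case: yz => [->|zy|yz|[u [uy uz]]]; [exact: Or43| | |].
  + by rewrite (child_inj zy xy); apply: Or41.
  + by case: (np _ _ _ _ xy yz).
  by rewrite (child_inj xy uy); apply: Or43.
apply: parent_child ux _; case: yz => [->|zy|yz|[v [vy vz]]]; [exact: Or43| | |].
- by rewrite (child_inj zy uy); apply: Or41.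
- by case: (np _ _ _ _ uy yz).
by rewrite (child_inj uy vy); apply: Or43.
Qed.

Lemma saturated_refuted S : proper_cs S -> (forall x f, ~ unsaturated S x f) ->
  exists (M : model At A) (w : world M), refuted w S.
Proof.
(* All positions are worlds; those outside the tree are related only to themselves and do no
   harm. *)
move=> pS nun; pose M := @Model At A pos (inhabits [::]) (cluster S)
  (fun a => cluster_equivalence a pS) (fun p x => is_true (Neg p \in comp_seq S x)).
exists M, [::]; have sat_S x f : f \in comp_seq S x -> saturated S x f.
  by move=> fx; apply: NNPP => nsat; apply: (nun x f).
have truth f (x : world M) : f \in comp_seq S x -> ~ sat x f.
  elim: f x => [||p|p|f IHf g IHg|f IHf g IHg|a f IHf|a f IHf] x fx /=; have := sat_S _ _ fx => /=.
  - by case.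
  - by [].
  - by move=> /negP.
  - by move=> _; apply.
  - by case=> [/IHf|/IHg] ns [].
  - by case=> /IHf nf /IHg ng [].
  - by case=> y [xy /IHf nf] all_f; apply: nf; apply: all_f.
  by move=> all_f [y [xy]]; apply: IHf; apply: all_f.
have R T : forall x, subtree S x = Some T -> refuted (x : world M) T.
  elim/cs_kid_ind: T => T IH x ST; constructor=> [f fT|a U kU].
    by apply: truth; rewrite /comp_seq ST.
  have [y [xy SU]] := kid_child ST kU; exists y; split; first exact: Or43.
  exact: IH kU _ SU.
exact: R.
Qed.

(** * Proof search *)

Section Progress.
Variables (F : seq form) (d : nat).
Hypothesis closedF : subform_closed F.

(** What search needs of a premise: the invariants, a smaller measure, and, as the last clause,
    invertibility, by which a premise of an irrefutable conclusion is irrefutable. *)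
Definition better S P :=
  [/\ proper_under None P, bounded F d P, measure F d P < measure F d S
    & forall (M : model At A) (w : world M), refuted w P -> refuted w S].

Lemma better_eq S P P' : cs_eq P P' -> better S P -> better S P'.
Proof.
move=> ProperUnder' [pP wP lt R]; split.
- by apply/(proper_under_cs_eq ProperUnder').
- exact: bounded_bisim (cs_eq_bisim ProperUnder') wP.
- by rewrite -(measure_cs_eq _ _ ProperUnder').
by move=> M w RP'; apply: R; apply: refuted_bisim (bisim_sym (cs_eq_bisim ProperUnder')) RP'.
Qed.

Lemma better_fill C X X' : hole_rest C = CS fset0 [::] ->
  proper_under None (fill C X) -> bounded F d (fill C X) ->
  (proper_under (hole_agent None C) X -> proper_under (hole_agent None C) X') ->
  (bounded F (d - size (hole C)) X -> bounded F (d - size (hole C)) X') ->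
  {subset root_seq X <= root_seq X'} ->
  measure F (d - size (hole C)) X' < measure F (d - size (hole C)) X ->
  (forall (M : model At A) (w : world M), refuted w X' -> refuted w X) ->
  better (fill C X) (fill C X').
Proof.
move=> hC pX wX pX' wX' sub lt R; split.
- by apply: proper_under_fill pX; rewrite hC !cs_merge0.
- by apply: bounded_fill wX; rewrite hC !cs_merge0.
- by rewrite -addn1; apply: (proj2 (measure_fill _ _)); rewrite hC !cs_merge0 ?addn1.
by move=> M w; apply: refuted_fill1 => v; apply: R.
Qed.

Lemma better_add C X G f : hole_rest C = CS fset0 [::] ->
  proper_under None (fill C X) -> bounded F d (fill C X) ->
  (forall g, g \in G -> g \in F /\ modal_depth g <= d - size (hole C)) ->
  f \in G -> f \notin root_seq X ->
  better (fill C X) (fill C (cs_merge (CS G [::]) X)).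
Proof.
move=> hC pX wX GF fG fX; apply: (better_fill hC pX wX).
- by move=> /proper_underP p; apply/proper_underP.
- move=> w; constructor=> [g|a T kT]; last exact: bounded_kid w kT.
  by rewrite root_merge in_fsetU => /orP[/GF|/(bounded_root w)].
- by move=> g gX; rewrite root_merge in_fsetU gX orbT.
- by apply: measure_add fX => //; case: (GF _ fG).
by move=> M w /refuted_merge[].
Qed.

(** [X'] is described by its children and their total measure only, which covers both enlarging a
    bracket and opening a new one. *)
Lemma better_new C X X' a f : hole_rest C = CS fset0 [::] ->
  proper_under None (fill C X) -> bounded F d (fill C X) ->
  f \in F -> modal_depth f < d - size (hole C) -> missing a X f ->
  root_seq X = root_seq X' ->
  (forall b T, kid X' b T <-> (b = a /\ T = leaf f) \/ kid X b T) ->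
  (forall d, kidsum F d X' = (kidsum F d X + measure F d.-1 (leaf f))%N) ->
  (proper_under (hole_agent None C) X -> proper_under (hole_agent None C) X') ->
  better (fill C X) (fill C X').
Proof.
move=> hC pX wX fF lt_f mf rX kX sX pX'; apply: (better_fill hC pX wX).
- exact: pX'.
- move=> w; constructor=> [g|b T /kX[[_ ->]|kT]]; last exact: bounded_kid w kT.
    by rewrite -rX; apply: bounded_root w.
  constructor=> [g /fset1P->|c U /kid_nil //]; split=> //.
  by rewrite -ltnS prednK // (leq_ltn_trans _ lt_f).
- by move=> g; rewrite rX.
- by apply: measure_new mf; rewrite ?(leq_ltn_trans _ lt_f).
move=> M w R; constructor=> [g|b T kT]; first by rewrite rX; apply: refuted_root R.
by apply: refuted_kid R _; apply/kX; right.
Qed.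

Lemma proper_under_leaf a f : proper_under (Some a) (leaf f).
Proof. by apply/proper_underP; split; [| | |move=> b T /kid_nil]. Qed.

Lemma better_new_in C G H B a f : hole_rest C = CS fset0 [::] ->
  proper_under None (fill C (CS G ((a, H) :: B))) -> bounded F d (fill C (CS G ((a, H) :: B))) ->
  f \in F -> modal_depth f < d - size (hole C) -> missing a (CS G ((a, H) :: B)) f ->
  better (fill C (CS G ((a, H) :: B))) (fill C (CS G ((a, leaf f :: H) :: B))).
Proof.
move=> hC pX wX fF lt_f mf; apply: (better_new hC pX wX fF lt_f mf).
- by [].
- move=> b T; split=> [[H' [/= [[<- <-]|HB] TH]]|[[-> ->]|[H' [/= [[<- <-]|HB] TH]]]].
  + case: TH => [<-|TH]; [by left|right].
    by exists H; split=> //; left.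
  + by right; exists H'; split=> //; right.
  + by exists (leaf f :: H); split; left.
  + by exists (leaf f :: H); split; [left|right].
  by exists H'; split=> //; right.
- by move=> d'; rewrite /kidsum /= -addnA addnC.
move=> /proper_underP[/= ne un na kS]; apply/proper_underP; split=> /=.
- by move=> p [<-//|pB]; apply: ne; right.
- exact: un.
- exact: na.
move=> b T [H' [/= [[<- <-]|HB] TH]]; last by apply: kS; exists H'; split=> //; right.
case: TH => [<-|TH]; first exact: proper_under_leaf.
by apply: kS; exists H; split=> //; left.
Qed.

(** The last two hypotheses protect properness: no [a]-bracket inside an [a]-bracket, and no second
    [a]-bracket at the component. *)
Lemma better_new_bracket C G B a f : hole_rest C = CS fset0 [::] ->
  proper_under None (fill C (CS G B)) -> bounded F d (fill C (CS G B)) ->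
  f \in F -> modal_depth f < d - size (hole C) -> missing a (CS G B) f ->
  hole_agent None C <> Some a -> a \notin [seq p.1 | p <- B] ->
  better (fill C (CS G B)) (fill C (CS G ((a, [:: leaf f]) :: B))).
Proof.
move=> hC pX wX fF lt_f mf nC naB; apply: (better_new hC pX wX fF lt_f mf).
- by [].
- move=> b T; split=> [[H' [/= [[<- <-]|HB] TH]]|[[-> ->]|[H' [/= HB TH]]]].
  + by case: TH => // <-; left.
  + by right; exists H'.
  + by exists [:: leaf f]; split; left.
  by exists H'; split=> //; right.
- by move=> d'; rewrite /kidsum /= addn0 addnC.
move=> /proper_underP[/= ne un na kS]; apply/proper_underP; split=> /=.
- by move=> p [<-//|pB]; apply: ne.
- by rewrite naB.
- by move=> b Eb; rewrite inE negb_or na // andbT; apply/eqP => Eab; apply: nC; rewrite -Eab.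
move=> b T [H' [/= [[<- <-]|HB] TH]]; last by apply: kS; exists H'.
by case: TH => [<-|//]; exact: proper_under_leaf.
Qed.

Lemma hole_agent_child o C X a : hole_agent o C = Some a ->
  (o = Some a /\ hole C = [::]) \/ exists z, child (fill C X) a z (hole C).
Proof.
elim: C o => [T|T b C IH H] o /=; first by left.
have Sk : subtree1 (cs_merge (CS fset0 [:: (b, fill C X :: H)]) T) (0, 0) =
    Some (b, fill C X) by [].
case/IH=> [[[->] ->]|[z cz]]; right.
  by exists [::]; apply/childP; exists (0, 0), (cs_merge (CS fset0 [:: (a, fill C X :: H)]) T),
    (fill C X).
by exists ((0, 0) :: z); apply: child_cons Sk cz.
Qed.

End Progress.

(** * One step of proof search, rule by rule *)

Lemma modal_depth_children f g : g \in children f -> modal_depth g <= modal_depth f.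
Proof.
case: f => //= [f h|f h|a f|a f]; rewrite !inE.
- by case/orP=> /eqP->; rewrite ?leq_maxl ?leq_maxr.
- by case/orP=> /eqP->; rewrite ?leq_maxl ?leq_maxr.
- by move/eqP->.
by move/eqP->.
Qed.

Lemma rcons_child S a z x : child S a z x -> exists k T U,
  [/\ x = rcons z k, size x = (size z).+1, subtree S z = Some T, subtree1 T k = Some (a, U)
    & kid T a U /\ comp_seq S x = root_seq U].
Proof.
case/childP=> k [T [U [-> ST TU]]]; exists k, T, U; split=> //; rewrite ?size_rcons //.
split; first by apply/kidP; exists k.
by rewrite /comp_seq subtree_rcons ST TU.
Qed.

Lemma comp_seq_subtree S x T : subtree S x = Some T -> comp_seq S x = root_seq T.
Proof. by rewrite /comp_seq => ->. Qed.

Section Step.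
Variables (F : seq form) (d : nat) (S : cs).
Hypotheses (closedF : subform_closed F) (pS : proper_under None S) (wS : bounded F d S).

Definition progress := exists S' Ps f x y,
  [/\ cs_eq S S', rule_inst Ps S' f x y, allowed S' f x y
    & forall P, List.In P Ps -> better F d S' P].

(** [T'] is [T] with the active children moved to the front. The last clause follows a child of [z]
    from its old index [k] to its new index [k']. *)
Lemma bring_front_spec z T T' : subtree S z = Some T -> cs_eq T T' ->
  exists C, let S' := fill C T' in
    [/\ hole_rest C = CS fset0 [::], cs_eq S S' /\ (proper_under None S' /\ bounded F d S'),
        along S S' z (hole C), size (hole C) = size z
      & forall k k' a U, subtree1 T k = Some (a, U) -> subtree1 T' k' = Some (a, U) ->
          along S S' (rcons z k) (rcons (hole C) k') /\
          comp_seq S' (rcons (hole C) k') = root_seq U].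
Proof.
move=> ST TT'; have [C [hC SS' zC]] := bring_front ST TT'.
have ST' : subtree (fill C T') (hole C) = Some T' by rewrite subtree_fill hC cs_merge0.
exists C; split; [exact: hC| |exact: zC|by rewrite (along_size zC)|].
  split; first exact: SS'.
  by split; [exact: (proj1 (proper_under_cs_eq SS' None))|
    exact: bounded_bisim (cs_eq_bisim SS') wS].
move=> k k' a U Tk T'k'; split.
  exact: along_rcons zC ST ST' Tk T'k' (bisim_refl U).
by rewrite /comp_seq subtree_rcons ST' T'k'.
Qed.

Section Principal.
Variables (x : pos) (f : form).
Hypotheses (uxf : unsaturated S x f) (minf : minimal S f).

Lemma principal_bound : f \in F /\ modal_depth f <= d - size x.
Proof.
by case: uxf => /comp_seqP[T [ST fT]] _; apply: bounded_root fT; apply: bounded_subtree ST.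
Qed.

Lemma principal_allowed S' x' y' : cs_eq S S' -> along S S' x x' ->
  (if f is Dia _ g then g \notin comp_seq S' y' else True) -> allowed S' f x' y'.
Proof.
move=> SS' xx' fy'; split=> //; first exact: along_unsaturated xx' uxf.
exact: minimal_bisim (cs_eq_bisim SS') minf.
Qed.

(** Treats at once all rules that affect only the component [x]: the axioms, with [Gs] empty, the
    Boolean rules and [R_dia_T]. *)
Lemma progress_local G (Gs : seq {fset form}) :
  G `<=` comp_seq S x ->
  (forall C, rule_inst [seq fill C (CS G' [::]) | G' <- Gs] (fill C (CS G [::]))
     f (hole C) (hole C)) ->
  (if f is Dia _ g then g \notin comp_seq S x else True) ->
  (forall G', List.In G' Gs -> (forall g, g \in G' -> g = f \/ g \in children f) /\
     exists2 g, g \in G' & g \notin comp_seq S x) ->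
  progress.
Proof.
case: (uxf) => /comp_seqP[T [ST fT]] _; rewrite (comp_seq_subtree ST) => GT rule nf GsP.
have [C [hC [SS' [pS' wS']] xC sC _]] := bring_front_spec ST (cs_eq_refl T).
have ST' : subtree (fill C T) (hole C) = Some T by rewrite subtree_fill hC cs_merge0.
have fillG : fill (ctx_comp C (CHole T)) (CS G [::]) = fill C T.
  by rewrite fill_rest cs_merge_id.
have := rule (ctx_comp C (CHole T)); rewrite fillG hole_comp_rest => r.
exists (fill C T), [seq fill (ctx_comp C (CHole T)) (CS G' [::]) | G' <- Gs], f, (hole C), (hole C).
split; [exact: SS'|exact: r|by apply: principal_allowed => //; rewrite (comp_seq_subtree ST')|].
move=> P /List.in_map_iff[G' [<- /GsP[Gf [g gG' gT]]]]; rewrite fill_rest.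
apply: (better_add hC pS' wS' _ gG' gT) => h /Gf hf; rewrite sC; have [fF le_f] := principal_bound.
case: hf => [->//|hf]; split; first exact: closedF hf.
exact: leq_trans (modal_depth_children hf) le_f.
Qed.

End Principal.

Lemma progress_dia_down x y a f : unsaturated S x (Dia a f) -> minimal S (Dia a f) ->
  child S a y x -> f \notin comp_seq S y -> progress.
Proof.
move=> ux mf /rcons_child[k [T [U [Ex sx ST TU [kU xU]]]]] fy.
have [H [B TT']] := kid_front kU; set T' := CS _ _ in TT'.
have [C [hC [SS' [pS' wS']] yC sC kC]] := bring_front_spec ST TT'.
have [xx' _] := kC k (0, 0) a U TU erefl; rewrite -Ex in xx'.
have fU : Dia a f \in root_seq U by rewrite -xU; case: ux.
have ET' : T' = cs_merge (CS fset0 [:: (a, cs_add (Dia a f) U :: H)]) (CS (root_seq T) B).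
  by rewrite cs_add_id // /cs_merge /= fset0U.
have := R_dia_down C a f (CS (root_seq T) B) U H; rewrite -ET' => r.
exists (fill C T'), [:: fill C (cs_add f T')], (Dia a f), (rcons (hole C) (0, 0)), (hole C).
split; [exact: SS'| | |].
- by move: r; rewrite {2}/T' cs_add_id // /cs_add /cs_merge /= fset0U.
- by apply: principal_allowed ux mf _ _ _ SS' xx' _; rewrite -(along_comp_seq yC).
move=> P [<-|[]]; have [fF le_f] := principal_bound ux.
apply: (better_add (f := f) hC pS' wS') => [g /fset1P->||].
- split; first by apply: closedF fF _; rewrite inE.
  by rewrite sC; move: le_f; rewrite sx subnS /=; case: (d - size y) => //= n /ltnW/leqW.
- exact: fset11.
by rewrite /T' /= -(comp_seq_subtree ST).
Qed.

Lemma progress_dia_up x y a f : unsaturated S x (Dia a f) -> minimal S (Dia a f) ->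
  child S a x y -> f \notin comp_seq S y -> progress.
Proof.
move=> ux mf /rcons_child[k [T [U [Ey sy ST TU [kU yU]]]]] fy.
have [H [B TT']] := kid_front kU; set T' := CS _ _ in TT'.
have [C [hC [SS' [pS' wS']] xC sC kC]] := bring_front_spec ST TT'.
have [yy' yU'] := kC k (0, 0) a U TU erefl; rewrite -Ey in yy'.
have fT : Dia a f \in root_seq T by rewrite -(comp_seq_subtree ST); case: ux.
(* Two readings of the same tree: [C0] has its hole at the parent, as the rule demands, and [C1] at
   the child that receives [f], as the measure demands. *)
pose C0 := ctx_comp C (CHole (CS (root_seq T) B)).
pose C1 := ctx_comp C (CIn (CS (root_seq T) B) a (CHole (CS fset0 [::])) H).
have fill0 V : fill C0 (CS [fset Dia a f] [:: (a, V :: H)]) = fill C1 V.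
  rewrite /C0 /C1 !fill_comp /= cs_merge0 /cs_merge /= fset0U; congr (fill C (CS _ _)).
  by apply/fsetUidPr; rewrite fsub1set.
have ET' : fill C T' = fill C1 U by rewrite /C1 fill_comp /= cs_merge0 /cs_merge /= fset0U.
have := R_dia_up C0 a f U H; rewrite !fill0 hole_comp_rest => r.
exists (fill C1 U), [:: fill C1 (cs_add f U)], (Dia a f), (hole C), (rcons (hole C) (0, 0)).
rewrite -ET'; split; [exact: SS'|by rewrite ET'| |].
  by apply: principal_allowed ux mf _ _ _ SS' xC _; rewrite yU' -yU.
move=> P [<-|[]]; have [fF le_f] := principal_bound ux; rewrite ET'.
apply: (better_add (f := f)) => [||| g /fset1P->||].
- by rewrite hole_rest_comp_in.
- by rewrite -ET'.
- by rewrite -ET'.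
- split; first by apply: closedF fF _; rewrite inE.
  rewrite hole_comp size_cat sC addn1 subnS; move: le_f => /=.
  by case: (d - size x).
- exact: fset11.
by rewrite -yU.
Qed.

Lemma progress_dia_in x y z a f : unsaturated S x (Dia a f) -> minimal S (Dia a f) ->
  child S a z x -> child S a z y -> f \in comp_seq S x -> f \notin comp_seq S y -> progress.
Proof.
move=> ux mf /rcons_child[k [T [U [Ex sx ST TU [kU xU]]]]].
case/rcons_child=> [k' [T0 [V [Ey sy ST0 TV [kV yV]]]]] fx fy.
move: ST0; rewrite ST => -[ET]; subst T0.
(* The siblings are distinct trees since only the first contains [f]. *)
have UV : U <> V by move=> EUV; rewrite yV -EUV -xU fx in fy.
have un : uniq [seq p.1 | p <- brackets T] by have [o /proper_underP[]] :=
  proper_under_subtree pS ST.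
have [H [B TT']] := kid_front2 un kU kV UV; set T' := CS _ _ in TT'.
have [C [hC [SS' [pS' wS']] zC sC kC]] := bring_front_spec ST TT'.
have [xx' _] := kC k (0, 0) a U TU erefl; rewrite -Ex in xx'.
have [_ yV'] := kC k' (0, 1) a V TV erefl.
have fU : Dia a f \in root_seq U by rewrite -xU; case: ux.
pose C0 := ctx_comp C (CHole (CS (root_seq T) B)).
pose C1 := ctx_comp C (CIn (CS (root_seq T) B) a (CHole (CS fset0 [::])) (U :: H)).
(* The rule changes the sibling with index 1, but a hole always has index 0; exchanging the two
   siblings reconciles them. *)
have swap W : cs_eq (fill C0 (CS fset0 [:: (a, U :: W :: H)])) (fill C1 W).
  have -> : fill C1 W = fill C0 (CS fset0 [:: (a, W :: U :: H)]).
    by rewrite /C0 /C1 !fill_comp /= cs_merge0.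
  by apply: cs_eq_hyper; apply: perm_swap.
have ET' : fill C T' = fill C0 (CS fset0 [:: (a, U :: V :: H)]).
  by rewrite /C0 fill_comp /= /cs_merge /= fset0U.
have := R_dia_in C0 a f U V H; rewrite hole_comp_rest cs_add_id // -ET' => r.
exists (fill C T'), [:: fill C0 (CS fset0 [:: (a, U :: cs_add f V :: H)])], (Dia a f),
  (rcons (hole C) (0, 0)), (rcons (hole C) (0, 1)).
split; [exact: SS'|exact: r|by apply: principal_allowed ux mf _ _ _ SS' xx' _; rewrite yV' -yV|].
move=> P [<-|[]]; have [fF le_f] := principal_bound ux.
have eqV : cs_eq (fill C T') (fill C1 V) by rewrite ET'.
apply: better_eq (cs_eq_sym (swap _)) _.
suff [p w m r'] : better F d (fill C1 V) (fill C1 (cs_add f V)).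
  split; [exact: p|exact: w|by rewrite (measure_cs_eq _ _ eqV)|].
  by move=> M w0 R; apply: refuted_bisim (bisim_sym (cs_eq_bisim eqV)) _; apply: r'.
apply: (better_add (f := f)) => [||| g /fset1P->||].
- by rewrite hole_rest_comp_in.
- by apply/(proper_under_cs_eq eqV).
- exact: bounded_bisim (cs_eq_bisim eqV) wS'.
- split; first by apply: closedF fF _; rewrite inE.
  by rewrite hole_comp size_cat sC addn1 -sx; apply: ltnW.
- exact: fset11.
by rewrite -yV.
Qed.

Lemma cluster_missing z T T' a f : subtree S z = Some T -> cs_eq T T' ->
  f \notin comp_seq S z -> (forall y, child S a z y -> f \notin comp_seq S y) -> missing a T' f.
Proof.
move=> ST TT' fz fk; have TT := cs_eq_bisim TT'.
apply/missingP; rewrite -(bisim_root TT) -(comp_seq_subtree ST); split=> // U'.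
case/(bisim_kid (bisim_sym TT))=> U [kU UU']; rewrite (bisim_root UU').
by have [y [zy SU]] := kid_child ST kU; rewrite -(comp_seq_subtree SU); apply: fk.
Qed.

Lemma progress_box_in x z a f : unsaturated S x (Box a f) -> minimal S (Box a f) ->
  child S a z x -> progress.
Proof.
move=> ux mf zx; have nsat := proj2 ux.
(* Since the box is unsaturated, [f] is absent from the parent [z] and from all its [a]-children,
   which together form the cluster of [x]. *)
have fz : f \notin comp_seq S z.
  by apply/negP => fz; apply: nsat; exists z; split=> //; apply: Or42.
have fk y : child S a z y -> f \notin comp_seq S y.
  by move=> zy; apply/negP => fy; apply: nsat; exists y; split=> //; apply: Or44; exists z.
have [k [T [U [Ex sx ST TU [kU xU]]]]] := rcons_child zx.
have [H [B TT']] := kid_front kU; set T' := CS _ _ in TT'.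
have mT' := cluster_missing ST TT' fz fk.
have [C [hC [SS' [pS' wS']] zC sC kC]] := bring_front_spec ST TT'.
have [xx' _] := kC k (0, 0) a U TU erefl; rewrite -Ex in xx'.
have fU : Box a f \in root_seq U by rewrite -xU; case: ux.
pose C0 := ctx_comp C (CHole (CS (root_seq T) B)).
have fill0 V : fill C0 (CS fset0 [:: (a, V)]) = fill C (CS (root_seq T) ((a, V) :: B)).
  by rewrite /C0 fill_comp /= /cs_merge /= fset0U.
have := R_box_in C0 a f U H; rewrite hole_comp_rest cs_add_id // !fill0 -/T' => r.
exists (fill C T'), [:: fill C (CS (root_seq T) ((a, leaf f :: U :: H) :: B))], (Box a f),
  (rcons (hole C) (0, 0)), (rcons (hole C) (0, 0)).
split; [exact: SS'|exact: r|exact: principal_allowed ux mf _ _ _ SS' xx' _|].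
move=> P [<-|[]]; have [fF le_f] := principal_bound ux.
apply: (better_new_in hC pS' wS' _ _ mT'); first by apply: closedF fF _; rewrite inE.
by rewrite sC; apply: leq_trans le_f _; rewrite sx subnS leq_pred.
Qed.

Lemma progress_box_up x y a f : unsaturated S x (Box a f) -> minimal S (Box a f) ->
  child S a x y -> progress.
Proof.
move=> ux mf xy; have nsat := proj2 ux.
have fx : f \notin comp_seq S x.
  by apply/negP => fx; apply: nsat; exists x; split=> //; apply: Or41.
have fk z : child S a x z -> f \notin comp_seq S z.
  by move=> xz; apply/negP => fz; apply: nsat; exists z; split=> //; apply: Or43.
have [k [T [U [Ex sx ST TU [kU xU]]]]] := rcons_child xy.
have [H [B TT']] := kid_front kU; set T' := CS _ _ in TT'.
have mT' := cluster_missing ST TT' fx fk.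
have [C [hC [SS' [pS' wS']] xC sC kC]] := bring_front_spec ST TT'.
have fT : Box a f \in root_seq T by rewrite -(comp_seq_subtree ST); case: ux.
pose C0 := ctx_comp C (CHole (CS (root_seq T) B)).
have fill0 V : fill C0 (CS [fset Box a f] [:: (a, V)]) = fill C (CS (root_seq T) ((a, V) :: B)).
  rewrite /C0 fill_comp /= /cs_merge /=; congr (fill C (CS _ _)).
  by apply/fsetUidPr; rewrite fsub1set.
have := R_box_up C0 a f (U :: H); rewrite hole_comp_rest !fill0 -/T' => r.
exists (fill C T'), [:: fill C (CS (root_seq T) ((a, leaf f :: U :: H) :: B))], (Box a f),
  (hole C), (hole C).
split; [exact: SS'|exact: r|exact: principal_allowed ux mf _ _ _ SS' xC _|].
move=> P [<-|[]]; have [fF le_f] := principal_bound ux.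
apply: (better_new_in hC pS' wS' _ _ mT'); first by apply: closedF fF _; rewrite inE.
by rewrite sC.
Qed.

(** Having no [a]-children is the side condition of the rule; not being an [a]-child keeps the
    premise proper. *)
Lemma progress_box_new x a f : unsaturated S x (Box a f) -> minimal S (Box a f) ->
  (forall z, ~ child S a z x) -> (forall y, ~ child S a x y) -> progress.
Proof.
move=> ux mf nzx nxy; have nsat := proj2 ux.
have fx : f \notin comp_seq S x.
  by apply/negP => fx; apply: nsat; exists x; split=> //; apply: Or41.
have [T [ST fT]] := comp_seqP (proj1 ux).
have mT : missing a T f by apply: cluster_missing ST (cs_eq_refl T) fx _ => y /nxy.
have [C [hC [SS' [pS' wS']] xC sC kC]] := bring_front_spec ST (cs_eq_refl T).
pose C0 := ctx_comp C (CHole T).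
have fill0 : fill C0 (leaf (Box a f)) = fill C T by rewrite fill_rest; congr fill; apply: cs_add_id.
have r : rule_inst [:: fill C0 (CS [fset Box a f] [:: (a, [:: leaf f])])] (fill C T)
    (Box a f) (hole C) (hole C).
  have := @R_box_new At A C0 a f; rewrite fill0 hole_comp_rest;
    apply=> z /(along_child (along_sym xC)).
  by case=> y [/nxy].
exists (fill C T), [:: fill C0 (CS [fset Box a f] [:: (a, [:: leaf f])])], (Box a f), (hole C),
  (hole C).
split; [exact: SS'|exact: r|exact: principal_allowed ux mf _ _ _ SS' xC _|].
move=> P [<-|[]]; have [fF le_f] := principal_bound ux.
case: T ST fT mT pS' wS' xC SS' {kC} @C0 fill0 r => G B ST fT mT pS' wS' xC SS' C0 fill0 r.
have -> : fill C0 (CS [fset Box a f] [:: (a, [:: leaf f])]) = fill C (CS G ((a, [:: leaf f]) :: B)).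
  rewrite /C0 fill_rest /cs_merge /=; congr (fill C (CS _ _)).
  by apply/fsetUidPr; rewrite fsub1set.
apply: (better_new_bracket hC pS' wS' _ _ mT).
- by apply: closedF fF _; rewrite inE.
- by rewrite sC.
- case/(hole_agent_child (CS G B))=> [[//]|[z /(along_parent (along_sym xC))[z' [/nzx]]]] //.
(* An existing [a]-bracket would be nonempty and so give [x] an [a]-child. *)
apply/agentP => -[H HB]; have [o /proper_underP[ne _ _ _]] := proper_under_subtree pS ST.
have [U kU] := bracket_kid (S := CS G B) HB (ne _ HB).
by have [y [/nxy]] := kid_child ST kU.
Qed.

Lemma progress_unsaturated x f : unsaturated S x f -> minimal S f -> progress.
Proof.
move=> ux mf; have fx := proj1 ux; have nsat := proj2 ux.
case: f ux mf fx nsat => [||p|p|f g|f g|a f|a f] ux mf fx nsat.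
- by case: nsat.
- by apply: (progress_local ux mf (G := [fset Top]) (Gs := [::])) => // [|C];
    rewrite ?fsub1set //; apply: R_top.
- apply: (progress_local ux mf (G := [fset Pos p; Neg p]) (Gs := [::])) => // [|C];
    last exact: R_id_pos.
  rewrite fsubUset !fsub1set fx /=; apply: contraT => np; by case: nsat.
- apply: (progress_local ux mf (G := [fset Pos p; Neg p]) (Gs := [::])) => // [|C];
    last exact: R_id_neg.
  rewrite fsubUset !fsub1set fx andbT; apply: contraT => np; by case: nsat.
- apply: (progress_local ux mf (G := [fset And f g])
    (Gs := [:: [fset And f g; f]; [fset And f g; g]])) => // [|C|G]; rewrite ?fsub1set //.
    exact: R_and.
  have [nf ng] : f \notin comp_seq S x /\ g \notin comp_seq S x.
    by split; apply/negP => ?; apply: nsat; [left|right].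
  case=> [<-|[<-|//]]; split.
  + by move=> h; rewrite !inE => /orP[] /eqP->; rewrite ?eqxx; [left|right].
  + by exists f; rewrite // !inE eqxx orbT.
  + by move=> h; rewrite !inE => /orP[] /eqP->; rewrite ?eqxx ?orbT; [left|right].
  by exists g; rewrite // !inE eqxx orbT.
- apply: (progress_local ux mf (G := [fset Or f g]) (Gs := [:: [fset Or f g; f; g]]))
    => // [|C|G]; rewrite ?fsub1set //.
    exact: R_or.
  case=> [<-|//]; split.
    by move=> h; rewrite !inE -orbA => /or3P[] /eqP->; rewrite ?eqxx ?orbT; [left|right|right].
  have [nf|nf] := boolP (f \in comp_seq S x); last by exists f; rewrite // !inE eqxx ?orbT.
  exists g; first by rewrite !inE eqxx !orbT.
  by apply/negP => ng; apply: nsat.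
- have [[z zx]|nzx] := classic (exists z, child S a z x); first exact: progress_box_in ux mf zx.
  have [[y xy]|nxy] := classic (exists y, child S a x y); first exact: progress_box_up ux mf xy.
  by apply: progress_box_new ux mf _ _ => y xy; [apply: nzx|apply: nxy]; exists y.
(* The component of the diamond is served first; afterwards it contains [f], which the sibling case
   needs to tell the two siblings apart. *)
have [nf|nf] := boolP (f \in comp_seq S x); last first.
  apply: (progress_local ux mf (G := [fset Dia a f]) (Gs := [:: [fset Dia a f; f]]))
    => // [|C|G]; rewrite ?fsub1set //.
    exact: R_dia_T.
  case=> [<-|//]; split; last by exists f; rewrite // !inE eqxx orbT.
  by move=> h; rewrite !inE => /orP[] /eqP->; rewrite ?eqxx; [left|right].
have [y ny] := not_all_ex_not _ _ nsat; have [xy /negP fy] := imply_to_and _ _ ny.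
case: xy fy => [->|yx|xy|[z [zx zy]]] fy.
- by rewrite nf in fy.
- exact: progress_dia_down ux mf yx fy.
- exact: progress_dia_up ux mf xy fy.
exact: progress_dia_in ux mf zx zy nf fy.
Qed.

End Step.

(** * Completeness and the equivalence *)

Lemma not_refuted_derivable F d S : subform_closed F -> proper_under None S -> bounded F d S ->
  (forall (M : model At A) (w : world M), ~ refuted w S) -> provable_restricted S.
Proof.
move=> cF; have [n] := ubnP (measure F d S); elim: n S => // n IH S lt_n pS wS nref.
have [[x [f ux]]|nun] := classic (exists x f, unsaturated S x f); last first.
  have [|M [w R]] := saturated_refuted (proper_under_cs pS); last by case: (nref M w).
  by move=> x f ux; apply: nun; exists x, f.
have [z [g [uz mg]]] := minimal_exists ux.
have [S' [Ps [h [x' [y' [SS' r ok bet]]]]]] := progress_unsaturated cF pS wS uz mg.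
apply: D_eq (cs_eq_sym SS') _; apply: D_rule r ok _ _ _.
- exact: proper_under_cs (proj1 (proper_under_cs_eq SS' None) pS).
- by move=> P /bet[/proper_under_cs].
move=> P /bet[pP wP lt R]; apply: IH => //.
  by apply: leq_trans lt _; rewrite -(measure_cs_eq _ _ SS') -ltnS.
by move=> M w /R RS'; apply: (nref M w); apply: refuted_bisim (bisim_sym (cs_eq_bisim SS')) RS'.
Qed.

End CrossSequents.

Theorem theorem2 (At : countType) (hAt : exists e : nat -> At, injective e)
    (A : finType) (hA : 0 < #|A|) (S : cs At A) (hS : proper_cs S) :
  (provable S <-> provable_restricted S) /\
  (provable_restricted S <-> valid S).
Proof.
have sound ok : derivable ok S -> valid S.
  by move=> /derivable_not_refuted; apply: not_refuted_valid.
have compl : valid S -> provable_restricted S.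
  have [F [d [cF wS]]] := bounded_exists S.
  by move=> /valid_not_refuted; apply: not_refuted_derivable cF (proper_cs_under hS) wS.
(* An unrestricted proof becomes a restricted one by passing through validity; the converse only
   forgets the restriction. *)
split; split; [by move/sound/compl| |exact: sound|exact: compl].
by apply: derivable_weaken.
Qed.
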